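(* Let $\Gamma$ be a countable discrete group and $\Lambda\leq\Gamma$ be a subgroup. Let $L$ be a $d$-dimensional simplicial complex with countably many simplices. If $\Gamma\curvearrowright L$ is a proper action such that the restriction to $\Lambda$ satisfies $\beta_d^{(2)}(\Lambda\curvearrowright L)\neq 0$, then $\beta_d^{(2)}(\Gamma\curvearrowright L)\neq 0$.
   Context: An action of a countable discrete group $\Gamma$ on a simplicial complex $L$ is proper if it is simplicial with finite stabilizers. The $\ell^2$-Betti numbers $\beta_k^{(2)}(\Gamma\curvearrowright L)$ of a proper action (not assumed cocompact; $L$ not assumed contractible) are defined as follows. Choose any increasing sequence $(L_i)_{i\in\mathbb{N}}$ of cocompact $\Gamma$-invariant subcomplexes of $L$ with union $L$. Each $L_i$ has uniformly bounded vertex valencies, so the simplicial boundary operators $\partial_k: C_k^{(2)}(L_i)\to C_{k-1}^{(2)}(L_i)$ on the Hilbert spaces of $\ell^2$-chains are bounded, and the reduced $\ell^2$-homology $\bar H_k^{(2)}(L_i)=\ker\partial_k/\overline{\mathrm{im}\,\partial_{k+1}}$ is a Hilbert $\Gamma$-module. Set $$\beta_k^{(2)}(\Gamma\curvearrowright L)=\lim_{i\to\infty}\ \lim_{j\to\infty,\, j\ge i}\dim_\Gamma \overline{\mathrm{im}}\left(\bar H_k^{(2)}(L_i)\to \bar H_k^{(2)}(L_j)\right),$$ where $\dim_\Gamma$ is the von Neumann dimension over $\Gamma$ and the maps are induced by the inclusions $L_i\subset L_j$ (the dimension is decreasing in $j$ and increasing in $i$). The value does not depend on the exhausting sequence. 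*)

(* Defs.v *)
From HB Require Import structures.
From mathcomp Require Import all_boot all_order all_algebra.
From mathcomp Require Import fingroup perm finmap complex.
From mathcomp Require Import all_classical all_reals all_analysis.

Set Implicit Arguments.
Unset Strict Implicit.
Unset Printing Implicit Defensive.

Import Order.TTheory GRing.Theory Num.Theory.

Local Open Scope fset_scope.
Local Open Scope classical_set_scope.
Local Open Scope ring_scope.

(* An abstract simplicial complex.  The vertices are the [v : V] such that
   [[fset v]] is a simplex; the other elements of [V] play no role, so that a
   complex and its subcomplexes live on the same type. *)
Record scomplex (V : choiceType) := SComplex {
  simplices : set {fset V};
  simplex_neq0 : forall s, simplices s -> s != fset0;
  simplex_face : forall s t : {fset V},
    simplices s -> t != fset0 -> (t `<=` s)%fset -> simplices t }.

Definition has_dim (V : choiceType) (L : scomplex V) (d : nat) : Prop :=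
  (forall s, simplices L s -> (#|` s| <= d.+1)%N) /\
  (exists2 s, simplices L s & #|` s| = d.+1).

Record gaction (G : groupType) (V : Type) := GAction {
  gact :> G -> V -> V;
  gact1 : forall v, gact 1%g v = v;
  gactM : forall g h v, gact (g * h)%g v = gact g (gact h v) }.

Section Restriction.
Variables (G : groupType) (S : {pred G}) (H : subGroupType S) (V : Type).
Variable a : gaction G V.

Lemma restr_gact1 v : a (val (1%g : H)) v = v.
Proof. by rewrite gmulf1 gact1. Qed.

Lemma restr_gactM (g h : H) v : a (val (g * h)%g) v = a (val g) (a (val h) v).
Proof. by rewrite gmulfM gactM. Qed.

Definition restr_gaction : gaction H V :=
  @GAction H V (fun h => a (val h)) restr_gact1 restr_gactM.

End Restriction.

Section Actions.
Variables (G : groupType) (V : choiceType) (a : gaction G V).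

Definition translate (g : G) (s : {fset V}) : {fset V} := [fset a g v | v in s].

Definition invariant (L : scomplex V) : Prop :=
  forall g s, simplices L s -> simplices L (translate g s).

Definition proper_action (L : scomplex V) : Prop :=
  invariant L /\
  forall s, simplices L s -> finite_set [set g | translate g s = s].

(* For an invariant complex: the quotient is compact iff there are finitely
   many orbits of simplices. *)
Definition cocompact (L : scomplex V) : Prop :=
  exists2 F : set {fset V}, finite_set F &
    (forall s, simplices L s -> exists g t, F t /\ s = translate g t).

Record exhaustion (L : scomplex V) (Ls : nat -> scomplex V) : Prop := {
  exh_invariant : forall i, invariant (Ls i);
  exh_cocompact : forall i, cocompact (Ls i);
  exh_increasing : forall i, simplices (Ls i) `<=` simplices (Ls i.+1);
  exh_union : \bigcup_i simplices (Ls i) = simplices L }.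

End Actions.

Section L2.
Variables (R : realType) (X : choiceType).
Implicit Types f h : X -> R[i].

Definition l2sqnorm f : \bar R :=
  \esum_(x in [set: X]) ((complex.Re (f x)) ^+ 2 + (complex.Im (f x)) ^+ 2)%:E.

(* The sum of an absolutely summable real family, as in [esumB]. *)
Definition rsum (u : X -> R) : R :=
  fine (esum [set: X] (EFin \o u)^\+ - esum [set: X] (EFin \o u)^\-)%E.

Definition l2dot f h : R[i] :=
  Complex (rsum (fun x => complex.Re (f x * (h x)^*)))
          (rsum (fun x => complex.Im (f x * (h x)^*))).

Definition is_orthoproj (W : set (X -> R[i])) f p : Prop :=
  W p /\ forall w, W w -> l2dot (f - p) w = 0.

Definition dirac_fun (x0 : X) : X -> R[i] := fun x => (x == x0)%:R.

End L2.

Arguments dirac_fun R {X}.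

Section Chains.
Variables (R : realType) (V : choiceType).

(* Chains of dimension [n - 1], as alternating functions of [n] vertices: the
   chain [f] is the sum of [f x * [x_0, ..., x_(n-1)]] over the simplices, one
   ordering [x] being chosen for each of them.  For n = 0 there is only the
   zero chain, since the empty set is not a simplex. *)
Definition chain (n : nat) := n.-tuple V -> R[i].

(* Each simplex is counted once for each of its orderings in [l2sqnorm]; the
   factor makes the oriented simplices orthonormal. *)
Definition chain_sqnorm n (f : chain n) : \bar R :=
  ((n`!%:R^-1)%:E * l2sqnorm f)%E.

Definition simplex_of n (x : n.-tuple V) : {fset V} := [fset v in tval x].

Definition l2chains (L : scomplex V) n : set (chain n) :=
  [set f : chain n |
   [/\ forall x, f x != 0 -> uniq x /\ simplices L (simplex_of x),
     forall (s : 'S_n) (x : n.-tuple V),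
       f [tuple tnth x (s i) | i < n] = (-1) ^+ s * f x &
     (chain_sqnorm f < +oo)%E]].

(* The linear extension of [x_0, ..., x_n] |-> sum_i (-1)^i [.., ^x_i, ..]:
   the coefficient of [y] in the boundary is the sum over [v] of the
   coefficients of [v, y].  The sum has finitely many nonzero terms if L is
   locally finite and [f] is supported in L.  The test on [y] is only relevant
   for n = 0, where it makes the boundary of a 0-chain zero instead of its
   augmentation. *)
Definition boundary (L : scomplex V) n (f : chain n.+1) : chain n :=
  fun y => if `[< simplices L (simplex_of y) >]
           then \sum_(v \in [set: V]) f [tuple of v :: y] else 0.

Definition cycles (L : scomplex V) k : set (chain k.+1) :=
  [set z : chain k.+1 | l2chains L z /\ boundary L z = (fun=> 0)].

Definition boundary_closure (L : scomplex V) k : set (chain k.+1) :=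
  [set b : chain k.+1 | l2chains L b /\ forall e : R, 0 < e ->
     exists2 c : chain k.+2, l2chains L c &
       (chain_sqnorm (b - boundary L c)%R < e%:E)%E].

Section Quotient.
Variable n : nat.
Implicit Types (A B : set (chain n)) (f : chain n).

(* A Hilbert space A / B, with B a closed subspace of A, is given by the pair
   of A and B; a subspace of A / B is given by its preimage in A. *)
Definition quot_sqnorm B f : \bar R :=
  ereal_inf [set chain_sqnorm (f - b) | b in B].

(* The closure in A / B of the image of S. *)
Definition quot_image_closure A B (S : set (chain n)) : set (chain n) :=
  [set f | A f /\ forall e : R, 0 < e ->
     exists2 s, S s & (quot_sqnorm B (f - s)%R < e%:E)%E].

Variables (G : groupType) (a : gaction G V).

Definition gchain (g : G) f : chain n := fun x => f (map_tuple (a g^-1%g) x).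

(* The left regular representation on l^2(G)^m, whose elements are functions
   on 'I_m * G. *)
Definition lregular m (g : G) (u : 'I_m * G -> R[i]) : 'I_m * G -> R[i] :=
  fun y => u (y.1, (g^-1 * y.2)%g).

(* [phi], defined on representatives, is a G-equivariant linear isometric
   embedding of A / B into l^2(G)^m. *)
Record module_embedding A B m (phi : chain n -> 'I_m * G -> R[i]) : Prop := {
  emb_linear : forall (c : R[i]) f h, A f -> A h ->
    phi (fun x => c * f x + h x) = (fun y => c * phi f y + phi h y);
  emb_equivariant : forall g f, A f -> phi (gchain g f) = lregular g (phi f);
  emb_isometric : forall f, A f -> l2sqnorm (phi f) = quot_sqnorm B f }.

(* [d] is the von Neumann dimension of the Hilbert G-module A / B: the von
   Neumann trace of the orthogonal projection of l^2(G)^m onto the image of an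
   embedding. *)
Definition is_vNdim A B (d : \bar R) : Prop :=
  exists m (phi : chain n -> 'I_m * G -> R[i]) (p : 'I_m -> 'I_m * G -> R[i]),
    [/\ module_embedding A B phi,
        forall i, is_orthoproj (phi @` A) (dirac_fun R (i, 1%g)) (p i) &
        d = (\sum_(i < m) complex.Re (l2dot (p i) (dirac_fun R (i, 1%g))))%:E].

(* The value does not depend on the embedding. *)
Definition vNdim A B : \bar R := get (is_vNdim A B).

End Quotient.

Section Betti.
Variables (G : groupType) (a : gaction G V).

(* The dimension of the closure of the image of the map from the reduced
   homology of K to that of L, for a subcomplex K of L. *)
Definition homology_image_dim (K L : scomplex V) k : \bar R :=
  vNdim a
    (quot_image_closure (cycles L (k := k)) (boundary_closure L (k := k))
                        (cycles K (k := k)))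
    (boundary_closure L (k := k)).

Definition l2betti_along (Ls : nat -> scomplex V) k : \bar R :=
  limn (fun i => limn (fun j => homology_image_dim (Ls i) (Ls (i + j)%N) k)).

(* The value does not depend on the exhaustion. *)
Definition l2betti (L : scomplex V) k : \bar R :=
  get [set b | exists2 Ls, exhaustion a L Ls & b = l2betti_along Ls k].

End Betti.

End Chains.

Arguments l2betti R {V G}.

(* Main.v *)
Require Import Defs.
From HB Require Import structures.
From mathcomp Require Import all_boot all_order all_algebra.
From mathcomp Require Import fingroup perm finmap complex.
From mathcomp Require Import all_classical all_reals all_analysis.
From mathcomp Require Import ring lra.

Set Implicit Arguments.
Unset Strict Implicit.
Unset Printing Implicit Defensive.

Import Order.TTheory GRing.Theory Num.Theory.
Import numFieldNormedType.Exports.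

Local Open Scope classical_set_scope.
Local Open Scope ring_scope.

(** In the top degree [d] there are no boundaries, so the reduced homology of a
    subcomplex is its space of square summable [d]-cycles, and inclusions of
    subcomplexes induce injective maps ([cycles_image_closure]). The Betti
    number along an exhaustion is therefore the supremum of the dimensions of
    the spaces of cycles of its members, and it is nonzero if and only if some
    member carries a nonzero square summable cycle ([l2betti_along_eq0] and
    [l2betti_along_neq0]). This criterion does not involve the group: if a
    subcomplex which is cocompact for the subgroup carries such a cycle, then so
    does every subcomplex that contains it ([cycles_mono]), and each exhaustion
    for the larger group has such a member, since it absorbs all translates of
    finitely many simplices ([exhaustion_absorbs]).

    For the criterion to hold, the dimensions must exist, vanish on the zero
    module only, and be monotone, so that the limit over the exhaustion exists
    and is at least each of its terms.

    Existence requires an equivariant isometry of the space of cycles into a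
    finite sum of copies of the regular representation; it reads a chain along
    the orbits of finitely many ordered simplices, suitably weighted
    ([orbit_embeddingP]). It also requires orthogonal projections onto the
    image, obtained by minimizing a distance ([orthoproj_exists]); cycles form a
    complete space because each of the conditions that define them involves
    finitely many coordinates, by local finiteness ([cycles_closed]).

    The trace of the projection is the sum of the square norms of the
    projections [p i] of the basis vectors at the unit of the group. It is
    faithful because the translates of the [p i] determine all coordinates
    ([trace_eq0]). For modules [A] inside [A'], embedded by [phi] and [phi'],
    the isometry [T] sending [phi f] to [phi' f] preserves the norms of the
    [p i], and the square norms of the [T (p i)] can be rearranged, by
    equivariance, into the square norms of the adjoint images of the [p' j],
    which are at most those of the [p' j] ([bessel], [trace_le]). *)

(** * Square summable functions *)
Section ComplexPlane.
Variable R : realType.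
Implicit Types z w c : R[i].

Definition csq z : R := complex.Re z ^+ 2 + complex.Im z ^+ 2.

(** The Euclidean scalar product of the plane. The Hermitian product is
    recovered from it by [Re_mulC] and [Im_mulC]; working with a real form makes
    every estimate below a statement about real numbers. *)
Definition cdot z w : R :=
  complex.Re z * complex.Re w + complex.Im z * complex.Im w.

Lemma csq_ge0 z : 0 <= csq z.
Proof. by rewrite addr_ge0 ?sqr_ge0. Qed.

Lemma csq0 : csq 0 = 0.
Proof. by rewrite /csq /= expr0n addr0. Qed.

Lemma csq_eq0 z : csq z <= 0 -> z = 0.
Proof.
move=> z0; have : csq z == 0 by rewrite eq_le z0 csq_ge0.
rewrite /csq paddr_eq0 ?sqr_ge0// !sqrf_eq0.
by case: z {z0} => x y /= /andP[/eqP-> /eqP->].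
Qed.

Lemma csqM z w : csq (z * w) = csq z * csq w.
Proof. by case: z => a b; case: w => c d; rewrite /csq /=; ring. Qed.

Lemma csqN z : csq (- z) = csq z.
Proof. by case: z => a b; rewrite /csq /= !sqrrN. Qed.

Lemma csqD z w : csq (z + w) <= 2 * csq z + 2 * csq w.
Proof.
case: z => a b; case: w => c d; rewrite /csq /=.
have := sqr_ge0 (a - c); have := sqr_ge0 (b - d); nra.
Qed.

Lemma cdotC z w : cdot z w = cdot w z.
Proof. by rewrite /cdot mulrC [X in _ + X]mulrC. Qed.

Lemma cdotzz z : cdot z z = csq z.
Proof. by rewrite /cdot /csq !expr2. Qed.

Lemma cdotDl z1 z2 w : cdot (z1 + z2) w = cdot z1 w + cdot z2 w.
Proof. by case: z1 z2 w => [a b] [c d] [e f]; rewrite /cdot /=; ring. Qed.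

Lemma cdotMl c z w : cdot (c * z) w = cdot z (c^* * w).
Proof. by case: c z w => [a b] [c d] [e f]; rewrite /cdot /=; ring. Qed.

Lemma cdotZl (t : R) z w : cdot (t%:C%C * z) w = t * cdot z w.
Proof. by case: z w => [c d] [e f]; rewrite /cdot /=; ring. Qed.

Lemma cdot_le z w : `|cdot z w| <= csq z + csq w.
Proof.
case: z w => [a b] [c d]; rewrite /cdot /csq ler_norml /=.
have := sqr_ge0 (a - c); have := sqr_ge0 (b - d).
have := sqr_ge0 (a + c); have := sqr_ge0 (b + d).
by move=> *; apply/andP; split; nra.
Qed.

Lemma cdot2_le z w : 2 * cdot z w <= csq z + csq w.
Proof.
case: z w => [a b] [c d]; rewrite /cdot /csq /=.
by have := sqr_ge0 (a - c); have := sqr_ge0 (b - d); nra.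
Qed.

Lemma csq_conj z : csq z^* = csq z.
Proof. by case: z => a b; rewrite /csq /= sqrrN. Qed.

Lemma Re_mulC z w : complex.Re (z * w^*) = cdot z w.
Proof. by case: z w => [a b] [c d]; rewrite /cdot /=; ring. Qed.

Lemma Im_mulC z w : complex.Im (z * w^*) = cdot z ('i%C * w).
Proof. by case: z w => [a b] [c d]; rewrite /cdot /=; ring. Qed.

End ComplexPlane.

Section RealSums.
Variables (R : realType) (X : choiceType).
Implicit Types u v : X -> R.

Definition tsum u : \bar R := \esum_(x in [set: X]) (u x)%:E.

Lemma tsum_ge0 u : (forall x, 0 <= u x) -> (0 <= tsum u)%E.
Proof. by move=> u0; apply: esum_ge0 => x _; rewrite lee_fin. Qed.

Lemma le_tsum u v : (forall x, u x <= v x) -> (tsum u <= tsum v)%E.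
Proof. by move=> uv; apply: le_esum => x _; rewrite lee_fin. Qed.

Lemma tsumD u v : (forall x, 0 <= u x) -> (forall x, 0 <= v x) ->
  tsum (fun x => u x + v x)%R = (tsum u + tsum v)%E.
Proof.
by move=> u0 v0; rewrite /tsum -esumD // => x _; rewrite lee_fin.
Qed.

Lemma tsum_ge_seq u (s : seq X) : uniq s -> (forall x, 0 <= u x) ->
  ((\sum_(x <- s) u x)%:E <= tsum u)%E.
Proof.
move=> us u0; apply: esum_ge; exists [set` s]; first by split.
by rewrite fsumEFin// fsbig_seq.
Qed.

Lemma tsum_le_seq u (m : R) : 
  (forall s : seq X, uniq s -> \sum_(x <- s) u x <= m) -> (tsum u <= m%:E)%E.
Proof.
move=> um; apply: ge_ereal_sup => _ [A [finA _] <-].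
rewrite fsumEFin// lee_fin fsbig_finite//=; exact: um.
Qed.

Lemma tsum_scale_le u (c : R) : 0 <= c -> (forall x, 0 <= u x) ->
  (tsum (fun x => c * u x)%R <= c%:E * tsum u)%E.
Proof.
move=> c0 u0; apply: ge_ereal_sup => _ [A [finA _] <-].
rewrite fsumEFin// fsbig_finite//= -big_distrr /= EFinM.
by rewrite lee_wpmul2l ?lee_fin// tsum_ge_seq.
Qed.

Lemma tsum_scale u (c : R) : 0 <= c -> (forall x, 0 <= u x) ->
  (tsum (fun x => c * u x)%R = c%:E * tsum u)%E.
Proof.
move=> c0 u0; apply/eqP; rewrite eq_le tsum_scale_le//=.
have [->|c_neq0] := eqVneq c 0.
  by rewrite mul0e tsum_ge0// => x; rewrite mul0r.
have {c0 c_neq0}c0 : 0 < c by rewrite lt_neqAle eq_sym c_neq0.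
have uE : u = (fun x => c^-1 * (c * u x)).
  by apply/funext => x; rewrite mulKf ?gt_eqF.
rewrite [X in (_ * tsum X)%E]uE.
have cu0 x : 0 <= c * u x by exact: mulr_ge0 (ltW c0) (u0 x).
have cV0 : 0 <= c^-1 by rewrite invr_ge0 ltW.
apply: (le_trans (lee_wpmul2l _ (tsum_scale_le cV0 cu0))).
  by rewrite lee_fin ltW.
by rewrite muleA -EFinM mulfV ?gt_eqF// mul1e.
Qed.

Definition abs_summable u := (tsum (fun x => `|u x|)%R < +oo)%E.

Lemma abs_summable_le u v : (forall x, `|u x| <= `|v x|) ->
  abs_summable v -> abs_summable u.
Proof. by move=> uv; apply: le_lt_trans; exact: le_tsum. Qed.

Lemma abs_summableD u v : abs_summable u -> abs_summable v ->
  abs_summable (fun x => u x + v x).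
Proof.
move=> su sv; apply: (@le_lt_trans _ _ (tsum (fun x => `|u x| + `|v x|)%R)).
  by apply: le_tsum => x; exact: ler_normD.
by rewrite tsumD//; exact: lte_add_pinfty.
Qed.

Lemma abs_summableZ t u : abs_summable u -> abs_summable (fun x => t * u x).
Proof.
move=> su; rewrite /abs_summable; under eq_fun do rewrite normrM.
by rewrite tsum_scale// lte_mul_pinfty.
Qed.

Lemma tsum_fin u : abs_summable u -> (forall x, 0 <= u x) ->
  (tsum u \is a fin_num).
Proof.
move=> su u0; rewrite ge0_fin_numE ?tsum_ge0//.
by apply: le_lt_trans su; apply: le_tsum => x; exact: ler_norm.
Qed.

(** The value does not depend on the way in which a family is written as a
    difference of nonnegative ones; this makes [rsum] additive. *)
Lemma rsum_diff u v : abs_summable u -> abs_summable v ->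
  (forall x, 0 <= u x) -> (forall x, 0 <= v x) ->
  rsum (fun x => u x - v x) = fine (tsum u) - fine (tsum v).
Proof.
move=> su sv u0 v0; rewrite -fineB ?tsum_fin//; congr fine.
by apply: (@esumB _ _ _ (EFin \o u) (EFin \o v)) => // x _; rewrite lee_fin.
Qed.

Lemma rsum_ge0E u : abs_summable u -> (forall x, 0 <= u x) ->
  rsum u = fine (tsum u).
Proof.
move=> su u0; have s0 : abs_summable (fun=> 0 : R).
  by rewrite /abs_summable /tsum esum1 // => x _; rewrite normr0.
have -> : u = (fun x => u x - 0) by apply/funext => x; rewrite subr0.
rewrite rsum_diff// [tsum (fun=> 0)]esum1 //= subr0.
by congr (fine (tsum _)); apply/funext => x; rewrite subr0.
Qed.

Lemma rsumD u v : abs_summable u -> abs_summable v ->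
  rsum (fun x => u x + v x) = rsum u + rsum v.
Proof.
move=> su sv.
have dec w : abs_summable w ->
  [/\ abs_summable (fun x => `|w x|), abs_summable (fun x => `|w x| - w x),
     forall x, 0 <= `|w x| - w x & w = fun x => `|w x| - (`|w x| - w x)].
  move=> sw; have sa : abs_summable (fun x => `|w x|).
    by apply: abs_summable_le sw => x; rewrite normr_id.
  split=> //.
  - have -> : (fun x => `|w x| - w x) = (fun x => `|w x| + (-1) * w x).
      by apply/funext => x; rewrite mulN1r.
    exact/abs_summableD/abs_summableZ.
  - by move=> x; rewrite subr_ge0 ler_norm.
  - by apply/funext => x; rewrite opprB addrC subrK.
have [su1 su2 pu eu] := dec _ su; have [sv1 sv2 pv ev] := dec _ sv.
rewrite [in RHS]eu [in RHS]ev.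
have -> : (fun x => u x + v x) = (fun x => (`|u x| + `|v x|) -
   ((`|u x| - u x) + (`|v x| - v x))) by apply/funext => x; ring.
rewrite !rsum_diff//; try by [exact: abs_summableD|move=> x; rewrite addr_ge0].
rewrite (tsumD _ pv) // (tsumD (u := fun x => `|u x|)) //.
by rewrite !fineD ?tsum_fin//; ring.
Qed.

Lemma rsumN u : abs_summable u -> rsum (fun x => - u x) = - rsum u.
Proof.
move=> su; apply/eqP; rewrite -addr_eq0 -rsumD//.
  rewrite rsum_ge0E.
  - by rewrite /tsum esum1// => x _; rewrite addNr.
  - by rewrite /abs_summable /tsum esum1// => x _; rewrite addNr normr0.
  - by move=> x; rewrite addNr.
by apply: abs_summable_le su => x; rewrite normrN.
Qed.

Lemma rsumZ t u : abs_summable u -> rsum (fun x => t * u x) = t * rsum u.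
Proof.
have pos w (s : R) : abs_summable w -> (forall x, 0 <= w x) -> 0 <= s ->
    rsum (fun x => s * w x) = s * rsum w.
  move=> sw w0 s0; rewrite !rsum_ge0E ?tsum_scale//.
  - by rewrite fineM// tsum_fin.
  - exact: abs_summableZ.
  - by move=> x; rewrite mulr_ge0.
have nneg w (s : R) : abs_summable w -> 0 <= s ->
  rsum (fun x => s * w x) = s * rsum w.
  move=> sw s0; have sa : abs_summable (fun x => `|w x|).
    by apply: abs_summable_le sw => x; rewrite normr_id.
  have sb : abs_summable (fun x => `|w x| - w x).
    have -> : (fun x => `|w x| - w x) = (fun x => `|w x| + (-1) * w x).
      by apply/funext => x; rewrite mulN1r.
    exact/abs_summableD/abs_summableZ.
  have b0 x : 0 <= `|w x| - w x by rewrite subr_ge0 ler_norm.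
  have e : (fun x => `|w x|) = (fun x => (`|w x| - w x) + w x).
    by apply/funext => x; rewrite subrK.
  have /(congr1 (fun h => s * rsum h)) := e.
  rewrite /= (rsumD sb sw) mulrDr => h.
  apply: (@addrI _ (rsum (fun x => s * (`|w x| - w x)))).
  rewrite -rsumD; try exact: abs_summableZ.
  have -> : (fun x => s * (`|w x| - w x) + s * w x) = (fun x => s * `|w x|).
    by apply/funext => x; ring.
  by rewrite !pos// h.
move=> su; have [t0|t0] := leP 0 t; first exact: nneg.
have -> : (fun x => t * u x) = (fun x => - ((- t) * u x)).
  by apply/funext => x; rewrite mulNr opprK.
rewrite rsumN; last exact: abs_summableZ.
by rewrite nneg// ?mulNr ?opprK// oppr_ge0 ltW.
Qed.

Lemma tsum_single u x0 : (forall x, x != x0 -> u x = 0) -> 0 <= u x0 ->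
  tsum u = (u x0)%:E.
Proof.
move=> u0 ux0; have := @esum_set1 R X x0 (EFin \o u).
rewrite /= lee_fin => /(_ ux0) <-.
rewrite [RHS]esum_mkcond; apply: eq_esum => x _; case: ifPn => //.
by move=> /negP; rewrite inE /= => /eqP /u0 ->.
Qed.

Lemma rsum_single u x0 : (forall x, x != x0 -> u x = 0) -> rsum u = u x0.
Proof.
move=> u0; have -> : u = (fun x => `|u x| - (`|u x| - u x)).
  by apply/funext => x; rewrite opprB addrC subrK.
have pos x : 0 <= `|u x| - u x by rewrite subr_ge0 ler_norm.
have z1 x : x != x0 -> `|u x| = 0 by move=> /u0 ->; rewrite normr0.
have z2 x : x != x0 -> `|u x| - u x = 0.
  by move=> /u0 ->; rewrite normr0 subr0.
rewrite rsum_diff//.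
- by rewrite (tsum_single z1)// (tsum_single z2).
- by rewrite /abs_summable (@tsum_single _ x0) ?ltry// => x /z1 ->;
  rewrite normr0.
- by rewrite /abs_summable (@tsum_single _ x0) ?ltry// => x /z2 ->;
  rewrite normr0.
Qed.

End RealSums.

Section L2Space.
Variables (R : realType) (X : choiceType).
Implicit Types f g h : X -> R[i].

Definition l2 f := (l2sqnorm f < +oo)%E.

Definition nsq f : R := fine (l2sqnorm f).

(** The real part of the Hermitian product of [l2]; see [l2dotE]. *)
Definition dot f g : R := rsum (fun x => cdot (f x) (g x)).

Lemma l2_summ f : l2 f -> abs_summable (fun x => csq (f x)).
Proof.
apply: le_lt_trans; apply: le_tsum => x.
by rewrite ger0_norm ?csq_ge0.
Qed.

Lemma summ_l2 f : abs_summable (fun x => csq (f x)) -> l2 f.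
Proof.
by apply: le_lt_trans; apply: le_tsum => x; exact: ler_norm.
Qed.

Lemma l2_fin f : l2 f -> l2sqnorm f \is a fin_num.
Proof. by move=> lf; apply: tsum_fin (l2_summ lf) _ => x; exact: csq_ge0. Qed.

Lemma nsqK f : l2 f -> l2sqnorm f = (nsq f)%:E.
Proof. by move=> lf; rewrite fineK// l2_fin. Qed.

Lemma l2_0 : l2 (fun=> 0).
Proof. by apply: summ_l2; rewrite /abs_summable /tsum esum1// => x _;
  rewrite csq0 normr0. Qed.

Lemma nsq_0 : nsq (fun=> 0) = 0.
Proof. by rewrite /nsq /l2sqnorm esum1// => x _ /=; rewrite expr0n/= addr0. Qed.

Lemma l2_lin c f g : l2 f -> l2 g -> l2 (fun x => c * f x + g x).
Proof.
move=> /l2_summ lf /l2_summ lg; apply: summ_l2.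
have sfg := abs_summableD (abs_summableZ (2 * csq c) lf) (abs_summableZ 2 lg).
apply: abs_summable_le sfg => x.
rewrite !ger0_norm ?csq_ge0 ?addr_ge0 ?mulr_ge0 ?csq_ge0//.
by apply: le_trans (csqD _ _) _; rewrite csqM mulrA.
Qed.

Lemma l2_scale c f : l2 f -> l2 (fun x => c * f x).
Proof.
move=> lf; have -> : (fun x => c * f x) = (fun x => c * f x + 0).
  by apply/funext => x; rewrite addr0.
exact: l2_lin lf l2_0.
Qed.

Lemma l2_add f g : l2 f -> l2 g -> l2 (fun x => f x + g x).
Proof.
move=> lf lg; have -> : (fun x => f x + g x) = (fun x => 1 * f x + g x).
  by apply/funext => x; rewrite mul1r.
exact: l2_lin.
Qed.

Lemma l2_sub f g : l2 f -> l2 g -> l2 (fun x => f x - g x).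
Proof.
move=> lf lg; have -> : (fun x => f x - g x) = (fun x => (-1) * g x + f x).
  by apply/funext => x; rewrite mulN1r addrC.
exact: l2_lin.
Qed.

Lemma dot_summ f g : l2 f -> l2 g -> abs_summable (fun x => cdot (f x) (g x)).
Proof.
move=> /l2_summ lf /l2_summ lg.
apply: abs_summable_le (abs_summableD lf lg) => x.
exact: le_trans (cdot_le _ _) (ler_norm _).
Qed.

Lemma nsq_ge0 f : 0 <= nsq f.
Proof. by rewrite fine_ge0// tsum_ge0// => x; exact: csq_ge0. Qed.

Lemma nsqE f : l2 f -> nsq f = dot f f.
Proof.
move=> lf; rewrite /dot; under eq_fun do rewrite cdotzz.
rewrite rsum_ge0E//; [exact: l2_summ|by move=> x; exact: csq_ge0].
Qed.

Lemma sum_csq_le f (s : seq X) : l2 f -> uniq s ->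
  \sum_(x <- s) csq (f x) <= nsq f.
Proof.
move=> lf us; rewrite -lee_fin -nsqK//.
by apply: (tsum_ge_seq us) => x; exact: csq_ge0.
Qed.

Lemma csq_le_nsq f x : l2 f -> csq (f x) <= nsq f.
Proof. by move=> lf; have := @sum_csq_le f [:: x] lf isT; rewrite big_seq1. Qed.

Lemma nsq_eq0 f : l2 f -> nsq f <= 0 -> f = (fun=> 0).
Proof.
move=> lf f0; apply/funext => x; apply: csq_eq0.
exact: le_trans (csq_le_nsq x lf) f0.
Qed.

Lemma dotC f g : dot f g = dot g f.
Proof. by congr rsum; apply/funext => x; rewrite cdotC. Qed.

Lemma dotDl f g h : l2 f -> l2 g -> l2 h ->
  dot (fun x => f x + g x) h = dot f h + dot g h.
Proof.
move=> lf lg lh; rewrite -rsumD; try exact: dot_summ.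
by congr rsum; apply/funext => x; rewrite cdotDl.
Qed.

Lemma dotMl c f g : dot (fun x => c * f x) g = dot f (fun x => c^* * g x).
Proof. by congr rsum; apply/funext => x; rewrite cdotMl. Qed.

Lemma dotZl (t : R) f g : l2 f -> l2 g ->
  dot (fun x => t%:C%C * f x) g = t * dot f g.
Proof.
move=> lf lg; rewrite -rsumZ; last exact: dot_summ.
by congr rsum; apply/funext => x; rewrite cdotZl.
Qed.

Lemma dotBl f g h : l2 f -> l2 g -> l2 h ->
  dot (fun x => f x - g x) h = dot f h - dot g h.
Proof.
move=> lf lg lh; apply/eqP; rewrite eq_sym subr_eq -dotDl//; last exact: l2_sub.
by under eq_fun do rewrite subrK.
Qed.

Lemma nsq_lin (t : R) f g : l2 f -> l2 g ->
  nsq (fun x => t%:C%C * f x + g x) = t ^+ 2 * nsq f + 2 * t * dot f g + nsq g.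
Proof.
move=> lf lg; have lt := l2_scale t%:C%C lf.
rewrite !nsqE//; last exact: l2_lin.
rewrite dotDl//; last exact: l2_lin.
rewrite dotZl//; last exact: l2_lin.
rewrite dotC dotDl// [X in _ + X]dotC dotDl// !dotZl// (dotC g f).
by rewrite !mulrDr; ring.
Qed.

Lemma nsq_scale (t : R) f : l2 f ->
  nsq (fun x => t%:C%C * f x) = t ^+ 2 * nsq f.
Proof.
move=> lf; have := nsq_lin t lf l2_0; rewrite nsq_0.
have -> : dot f (fun=> 0) = 0.
  rewrite dotC; have -> : (fun=> 0) = (fun x => 0%:C%C * f x).
    by apply/funext => x; rewrite mul0r.
  by rewrite dotZl// mul0r.
rewrite mulr0 !addr0 => <-; congr nsq; by apply/funext => x; rewrite addr0.
Qed.

Lemma nsqD f g : l2 f -> l2 g ->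
  nsq (fun x => f x + g x) = nsq f + 2 * dot f g + nsq g.
Proof.
move=> lf lg; have := nsq_lin 1 lf lg.
rewrite expr1n mulr1 mul1r => <-.
by congr nsq; apply/funext => x; rewrite mul1r.
Qed.

Lemma nsqB f g : l2 f -> l2 g ->
  nsq (fun x => f x - g x) = nsq f - 2 * dot f g + nsq g.
Proof.
move=> lf lg; have := nsq_lin (-1) lg lf.
have -> : (fun x => (-1)%:C%C * g x + f x) = (fun x => f x - g x).
  by apply/funext => x; rewrite rmorphN rmorph1 mulN1r addrC.
by move=> ->; rewrite (dotC g f); ring.
Qed.

Lemma nsqC f g : nsq (fun x => f x - g x) = nsq (fun x => g x - f x).
Proof.
rewrite /nsq; congr fine; apply: eq_esum => x _; congr EFin.
by rewrite -[f x - g x]opprB; exact: csqN.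
Qed.

(** Weaker than the Cauchy-Schwarz inequality, but enough to derive [S <= N]
    from [S <= dot f g], [nsq f <= S] and [nsq g <= N]. *)
Lemma dot_le_nsq f g : l2 f -> l2 g -> 2 * dot f g <= nsq f + nsq g.
Proof.
by move=> lf lg; have := nsq_ge0 (fun x => f x - g x); rewrite nsqB//; lra.
Qed.

Lemma nsqD_le (e : R) f g : l2 f -> l2 g -> 0 < e ->
  nsq (fun x => f x + g x) <= (1 + e) * nsq f + (1 + e^-1) * nsq g.
Proof.
move=> lf lg e0; rewrite nsqD//.
suff : 2 * dot f g <= e * nsq f + e^-1 * nsq g by lra.
rewrite -(ler_pM2l e0).
have := nsq_ge0 (fun x => (- e)%:C%C * f x + g x); rewrite nsq_lin//.
have -> : e * (e * nsq f + e^-1 * nsq g) = e ^+ 2 * nsq f + nsq g.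
  by rewrite mulrDr !mulrA mulfV ?gt_eqF// mul1r expr2.
by lra.
Qed.

Lemma l2dotE f g :
  l2dot f g = Complex (dot f g) (dot f (fun x => 'i%C * g x)).
Proof.
rewrite /l2dot; congr Complex; congr rsum; apply/funext => x.
  exact: Re_mulC.
exact: Im_mulC.
Qed.

Lemma l2_dirac x0 : l2 (dirac_fun R x0).
Proof.
apply: summ_l2; rewrite /abs_summable (@tsum_single _ _ _ x0) ?ltry// => x xx0.
by rewrite /dirac_fun (negbTE xx0) csq0 normr0.
Qed.

Lemma dot_dirac f x0 : dot f (dirac_fun R x0) = complex.Re (f x0).
Proof.
rewrite /dot (@rsum_single _ _ _ x0).
  by rewrite /cdot /dirac_fun eqxx /= mulr1 mulr0 addr0.
by move=> x xx0; rewrite /cdot /dirac_fun (negbTE xx0) /= !mulr0 addr0.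
Qed.

Definition l2cauchy (f_ : nat -> X -> R[i]) := forall e : R, 0 < e ->
  exists n0, forall n m, (n0 <= n)%N -> (n0 <= m)%N ->
    nsq (fun x => f_ n x - f_ m x) <= e.

Definition l2cvg (f_ : nat -> X -> R[i]) f := forall e : R, 0 < e ->
  exists n0, forall n, (n0 <= n)%N -> nsq (fun x => f_ n x - f x) <= e.

Lemma inv_succ_le (e : R) : 0 < e ->
  exists n0, forall n, (n0 <= n)%N -> n.+1%:R^-1 <= e.
Proof.
move=> e0; exists (Num.truncn e^-1) => n n0n.
rewrite -[e]invrK lef_pV2 ?posrE ?invr_gt0//.
apply/ltW/(lt_le_trans (truncnS_gt _)).
by rewrite ler_nat.
Qed.

Lemma real_cauchy_lim (u_ : nat -> R) :
  (forall e : R, 0 < e -> exists n0, forall n m, (n0 <= n)%N -> (n0 <= m)%N ->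
    (u_ n - u_ m) ^+ 2 <= e) -> exists l : R, u_ @ \oo --> l.
Proof.
move=> cu; apply/cvg_ex; apply/cauchy_cvgP/cauchy_ballP => e e0.
have [n0 n0P] := cu ((e / 2) ^+ 2) ltac:(by rewrite exprn_gt0 // divr_gt0).
exists (u_ @` [set n | (n0 <= n)%N], u_ @` [set n | (n0 <= n)%N]) => /=.
  by split; exists n0 => // n /= n0n; exists n.
move=> [_ _] [[n n0n <-] [m n0m <-]]; rewrite /ball /=.
apply: (@le_lt_trans _ _ (e / 2)); last first.
  by rewrite ltr_pdivrMr// mulr2n mulrDr mulr1 ltrDl.
rewrite -(@ler_pXn2r _ 2)// ?nnegrE ?divr_ge0 ?(ltW e0)//.
by rewrite real_normK ?num_real// n0P.
Qed.

(** The coordinates converge; for a finite set of coordinates the partial square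
    norm of [f_ n - f_ m] is bounded uniformly in the set, and the bound
    survives the limit in [m]. *)
Lemma l2_cauchy_cvg (f_ : nat -> X -> R[i]) : (forall n, l2 (f_ n)) ->
  l2cauchy f_ ->
  exists2 f, l2 f & l2cvg f_ f.
Proof.
move=> lf cf.
have cRe x : exists l : R, (fun n => complex.Re (f_ n x)) @ \oo --> (l : R).
  apply: real_cauchy_lim => e /cf[n0 n0P]; exists n0 => n m n0n n0m.
  apply: le_trans (n0P _ _ n0n n0m).
  apply: le_trans (csq_le_nsq x (l2_sub (lf n) (lf m))).
  by rewrite /csq; case: (f_ n x) (f_ m x) => [a b] [c d] /=;
    rewrite lerDl sqr_ge0.
have cIm x : exists l : R, (fun n => complex.Im (f_ n x)) @ \oo --> (l : R).
  apply: real_cauchy_lim => e /cf[n0 n0P]; exists n0 => n m n0n n0m.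
  apply: le_trans (n0P _ _ n0n n0m).
  apply: le_trans (csq_le_nsq x (l2_sub (lf n) (lf m))).
  by rewrite /csq; case: (f_ n x) (f_ m x) => [a b] [c d] /=;
    rewrite lerDr sqr_ge0.
have [re reP] := choice cRe; have [im imP] := choice cIm.
pose f x := Complex (re x) (im x).
have key (e : R) : 0 < e -> exists n0, forall n, (n0 <= n)%N ->
    (l2sqnorm (fun x => (f_ n x - f x)%R) <= e%:E)%E.
  move=> /cf[n0 n0P]; exists n0 => n n0n; apply: tsum_le_seq => s us.
  have cvs : (fun m => \sum_(x <- s) csq (f_ n x - f_ m x)) @ \oo -->
      \sum_(x <- s) csq (f_ n x - f x).
    elim: (s) => [|x t IH].
      by rewrite big_nil; under eq_fun do rewrite big_nil; exact: cvg_cst.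
    rewrite big_cons; under eq_fun do rewrite big_cons.
    apply: cvgD IH.
    have -> : (fun m => csq (f_ n x - f_ m x)) = (fun m =>
        (complex.Re (f_ n x) - complex.Re (f_ m x)) ^+ 2 +
        (complex.Im (f_ n x) - complex.Im (f_ m x)) ^+ 2).
      by apply/funext => m; rewrite /csq;
        case: (f_ n x) (f_ m x) => [a b] [c d].
    have -> : csq (f_ n x - f x) = (complex.Re (f_ n x) - re x) ^+ 2 +
        (complex.Im (f_ n x) - im x) ^+ 2.
      by rewrite /csq; case: (f_ n x) => a b.
    by apply: cvgD; rewrite expr2; under eq_fun do rewrite expr2;
      apply: cvgM; apply: cvgB; first [exact: cvg_cst|exact: reP|exact: imP].
  apply: (cvgr_to_le cvs); near=> m.
  apply: le_trans (n0P n m n0n _); last by near: m; exact: nbhs_infty_ge.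
  exact: sum_csq_le (l2_sub _ _) us.
have ld n0 (e : R) : (l2sqnorm (fun x => (f_ n0 x - f x)%R) <= e%:E)%E ->
    l2 (fun x => f_ n0 x - f x).
  by move=> le; apply: le_lt_trans le _; rewrite ltry.
exists f.
  have [n0 n0P] := key 1 ltr01.
  have := l2_sub (lf n0) (ld _ _ (n0P n0 (leqnn _))).
  by under eq_fun do rewrite opprB addrC subrK.
move=> e /key[n0 n0P]; exists n0 => n /n0P le.
by rewrite -lee_fin -nsqK//; exact: ld le.
Unshelve. all: by end_near. Qed.

End L2Space.

(** * Orthogonal projections *)
Section Subspaces.
Variables (R : realType) (X : choiceType).
Implicit Types (W : set (X -> R[i])) (f g h : X -> R[i]).

Record l2subspace W : Prop := {
  subspace_l2 : forall f, W f -> l2 f;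
  subspace_0 : W (fun=> 0);
  subspace_lin : forall c f g, W f -> W g -> W (fun x => c * f x + g x) }.

Definition l2closed W := forall (f_ : nat -> X -> R[i]) f,
  (forall n, W (f_ n)) -> l2 f -> l2cvg f_ f -> W f.

Definition l2complete W := forall f_ : nat -> X -> R[i],
  (forall n, W (f_ n)) -> l2cauchy f_ -> exists2 f, W f & l2cvg f_ f.

Lemma subspace_scale W c f : l2subspace W -> W f -> W (fun x => c * f x).
Proof.
move=> sW Wf; have -> : (fun x => c * f x) = (fun x => c * f x + 0).
  by apply/funext => x; rewrite addr0.
exact: (subspace_lin sW) (subspace_0 sW).
Qed.

Lemma subspace_sub W f g : l2subspace W -> W f -> W g -> W (fun x => f x - g x).
Proof.
move=> sW Wf Wg; have -> : (fun x => f x - g x) = (fun x => (-1) * g x + f x).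
  by apply/funext => x; rewrite mulN1r addrC.
exact: (subspace_lin sW).
Qed.

Lemma closed_complete W : l2subspace W -> l2closed W -> l2complete W.
Proof.
move=> sW clW f_ Wf cf.
have lf n : l2 (f_ n) by exact: subspace_l2 (Wf n).
have [f l2f cvf] := l2_cauchy_cvg lf cf.
by exists f => //; exact: clW cvf.
Qed.

(** Over a complex subspace, orthogonality for the real product gives
    orthogonality for the Hermitian one: test against [w] and [i w]. *)
Lemma orthoprojP W f p : l2subspace W -> l2 f -> W p ->
  is_orthoproj W f p <-> forall w, W w -> dot p w = dot f w.
Proof.
move=> sW lf Wp; have lp := subspace_l2 sW Wp.
have E w : W w -> dot (fun x => f x - p x) w = dot f w - dot p w.
  by move=> Ww; rewrite dotBl//; exact: subspace_l2 Ww.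
split=> [[_ fpW] w Ww|fpW].
  have := fpW w Ww; rewrite l2dotE => -[+ _]; rewrite [dot _ _]E// => /eqP.
  by rewrite subr_eq0 eq_sym => /eqP.
split=> // w Ww; rewrite l2dotE [dot _ w]E// fpW// subrr.
have Wi := subspace_scale 'i%C sW Ww.
by rewrite [dot _ _]E// fpW// subrr.
Qed.

Section Projection.
Variables (W : set (X -> R[i])) (h : X -> R[i]).
Hypotheses (sW : l2subspace W) (cW : l2complete W) (lh : l2 h).

Let dist w := nsq (fun x => h x - w x).
Let dists := [set dist w | w in W].
Let m := inf dists.

Let has_inf_dists : has_inf dists.
Proof.
split; first by exists (dist (fun=> 0)); exists (fun=> 0) => //;
  exact: subspace_0.
by exists 0 => _ [w _ <-]; exact: nsq_ge0.
Qed.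

Let m_le w : W w -> m <= dist w.
Proof. by move=> Ww; apply: ge_inf; [exact: has_inf_dists.2|exists w]. Qed.

Let m_ge0 : 0 <= m.
Proof.
apply: lb_le_inf; first exact: has_inf_dists.1.
by move=> _ [w _ <-]; exact: nsq_ge0.
Qed.

Let lhw w : W w -> l2 (fun x => h x - w x).
Proof. by move=> Ww; apply: l2_sub => //; exact: subspace_l2 Ww. Qed.

(** By the parallelogram identity, as the midpoint of [w] and [w'] is not closer
    to [h] than the infimum. *)
Let minimizing_cauchy w w' e e' : W w -> W w' -> dist w <= m + e ->
  dist w' <= m + e' -> nsq (fun x => w x - w' x) <= 2 * (e + e').
Proof.
move=> Ww Ww' we we'.
pose mid x := (2^-1 : R)%:C%C * (w x + w' x).
have Wmid : W mid.
  apply: subspace_scale => //.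
  have -> : (fun x => w x + w' x) = (fun x => 1 * w x + w' x).
    by apply/funext => x; rewrite mul1r.
  exact: subspace_lin.
have := m_le Wmid.
have -> : dist mid = 2^-1 ^+ 2 * nsq (fun x => (h x - w x) + (h x - w' x)).
  rewrite -nsq_scale; last by apply: l2_add; exact: lhw.
  congr nsq; apply/funext => x.
  rewrite /mid -[X in X - _ = _]mul1r.
  have <- : (2^-1 : R)%:C%C + (2^-1 : R)%:C%C = 1.
    by rewrite -rmorphD -[2^-1]div1r -splitr.
  by ring.
rewrite (nsqD (lhw Ww) (lhw Ww')).
have -> : nsq (fun x => w x - w' x) =
    nsq (fun x => (h x - w' x) - (h x - w x)).
  by congr nsq; apply/funext => x; ring.
rewrite (nsqB (lhw Ww') (lhw Ww)).
rewrite (dotC (fun x => h x - w' x)).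
move: we we'; rewrite /dist.
set a := nsq _; set b := nsq _; set c := dot _ _.
by lra.
Qed.

Let minimum : exists2 p, W p & dist p <= m.
Proof.
have /choice[w_ w_P] n : exists w, W w /\ dist w <= m + n.+1%:R^-1.
  have [] := @inf_adherent _ dists n.+1%:R^-1 _ has_inf_dists.
    by rewrite invr_gt0.
  by move=> _ [w Ww <-] /ltW le; exists w.
have [|p Wp cp] := @cW w_ (fun n => (w_P n).1).
  move=> e e0; have [n0 n0P] := inv_succ_le (divr_gt0 e0 (ltr0Sn R 3)).
  exists n0 => n k n0n n0k.
  apply: le_trans (minimizing_cauchy (w_P n).1 (w_P k).1 (w_P n).2 (w_P k).2) _.
  move: (n0P _ n0n) (n0P _ n0k).
  by move: n.+1%:R^-1 k.+1%:R^-1 => a b; lra.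
exists p => //.
(* Splitting [h - p] through a near minimizer [w_ n], with [nsq (w_ n - p)]
   below [e ^+ 2], costs an error which is linear in [e]. *)
suff main (e : R) : 0 < e -> e <= 1 -> dist p <= m + e * (m + 4).
  apply/ler_addgt0Pr => e e0.
  have k0 : 0 < m + 4 by rewrite ltr_wpDl.
  have d0 : 0 < Num.min 1 (e / (m + 4)) by rewrite lt_min ltr01 divr_gt0.
  apply: le_trans (main _ d0 _) _; first by rewrite ge_min lexx.
  by rewrite lerD2l -ler_pdivlMr// ge_min lexx orbT.
move=> e0 e1.
have [n0 n0P] := inv_succ_le e0.
have [n1 n1P] := cp (e ^+ 2) ltac:(by rewrite exprn_gt0).
pose n := maxn n0 n1.
have wn := w_P n; have Wn := wn.1.
have -> : dist p = nsq (fun x => (h x - w_ n x) + (w_ n x - p x)).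
  by congr nsq; apply/funext => x; rewrite addrA subrK.
have lwp : l2 (fun x => w_ n x - p x) by apply: l2_sub;
  exact: subspace_l2 sW _ _.
apply: le_trans (nsqD_le (lhw Wn) lwp e0) _.
have A1 := le_trans wn.2 (lerD (lexx m) (n0P n (leq_maxl _ _))).
have A2 := n1P n (leq_maxr _ _).
have B1 : (1 + e) * nsq (fun x => h x - w_ n x) <= (1 + e) * (m + e).
  by apply: ler_wpM2l => //; rewrite addr_ge0// ltW.
have B2 : (1 + e^-1) * nsq (fun x => w_ n x - p x) <= (1 + e^-1) * e ^+ 2.
  by apply: ler_wpM2l => //; rewrite addr_ge0// invr_ge0 ltW.
have B3 : (1 + e^-1) * e ^+ 2 = e ^+ 2 + e.
  by rewrite mulrDl mul1r expr2 mulrA mulVf ?gt_eqF// mul1r.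
have := m_ge0; nra.
Qed.

(** The projection is a point of least distance: moving it along [v] does not
    decrease the distance to [h], so the derivative in this direction is 0. *)
Lemma orthoproj_exists : exists p, is_orthoproj W h p.
Proof.
have [p Wp pm] := minimum; exists p; apply/orthoprojP => // v Wv.
apply/eqP; rewrite eq_sym -subr_eq0 -dotBl//; try exact: subspace_l2 sW _ _.
set D := dot _ _; apply/eqP.
have lv := subspace_l2 sW Wv.
(* The optimal step is [D / nsq v]; adding 1 avoids the case [nsq v = 0]. *)
pose t : R := - (D / (nsq v + 1)).
have Wt : W (fun x => p x - t%:C%C * v x) by apply: subspace_sub => //;
  exact: subspace_scale.
have := le_trans pm (m_le Wt); rewrite /dist.
have -> : (fun x => h x - (p x - t%:C%C * v x)) =
    (fun x => t%:C%C * v x + (h x - p x)).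
  by apply/funext => x; ring.
rewrite nsq_lin//; last exact: lhw.
rewrite dotC -/D; set a := nsq (fun x => _); set N := nsq v => le.
have N0 : 0 <= N by exact: nsq_ge0.
have N1 : 0 < N + 1 by rewrite ltr_wpDl.
have {}le : 0 <= t ^+ 2 * N + 2 * t * D by lra.
have tE : t * (N + 1) = - D by rewrite /t mulNr divfK// gt_eqF.
have : 0 <= (t ^+ 2 * N + 2 * t * D) * (N + 1) ^+ 2.
  by rewrite mulr_ge0// exprn_ge0// ltW.
have -> : (t ^+ 2 * N + 2 * t * D) * (N + 1) ^+ 2 =
   (t * (N + 1)) ^+ 2 * N + 2 * (t * (N + 1)) * D * (N + 1) by ring.
rewrite tE => le2.
have : D ^+ 2 <= 0 by have := sqr_ge0 D; nra.
by move=> D2; apply/eqP; rewrite -sqrf_eq0 eq_le D2 sqr_ge0.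
Qed.

End Projection.
End Subspaces.

(** * The von Neumann trace *)
Section SumsOverProducts.
Variable R : realType.

Lemma tsum_reindex (X Y : choiceType) (e : X -> Y) (u : Y -> R) :
  bijective e -> tsum u = tsum (fun x => u (e x)).
Proof.
move=> be; apply: (@reindex_esum R X Y setT setT e); split=> //.
  by move=> x y _ _; apply: bij_inj.
by move=> y _; case: be => e' _ e'K; exists (e' y).
Qed.

Lemma rsum_reindex (X Y : choiceType) (e : X -> Y) (u : Y -> R) :
  bijective e -> rsum u = rsum (fun x => u (e x)).
Proof.
move=> be; rewrite /rsum.
have bijT : set_bij [set: X] [set: Y] e.
  split=> //; first by move=> x y _ _; apply: bij_inj.
  by move=> y _; case: be => e' _ e'K; exists (e' y).
have H a := @reindex_esum R X Y setT setT e a bijT.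
rewrite (H (EFin \o u)^\+%E) (H (EFin \o u)^\-%E).
by congr (fine (_ - _)%E); apply: eq_esum => x _; rewrite ?funeposE ?funenegE.
Qed.

Lemma tsum_ord (m : nat) (Y : choiceType) (u : 'I_m * Y -> R) :
  (forall x, 0 <= u x) ->
  tsum u = (\sum_(i < m) tsum (fun y => u (i, y)))%E.
Proof.
move=> u0.
transitivity (\esum_(i in [set: 'I_m]) \esum_(y in [set: Y]) (u (i, y))%:E).
  rewrite esum_esum; last by move=> i y _ _; rewrite lee_fin.
  rewrite /tsum (_ : [set: 'I_m] `*`` _ = setT); last first.
    by apply/seteqP; split=> -[].
  by apply: eq_esum => -[].
rewrite esum_fset; [|exact: finite_finset|]; last first.
  by move=> i _; apply: esum_ge0 => y _; rewrite lee_fin.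
rewrite (fsbig_fwiden (index_enum 'I_m)) ?index_enum_uniq//.
  by move=> i _ /=; rewrite mem_index_enum.
by move=> i [_ []].
Qed.

End SumsOverProducts.

Section Chains.
Variables (R : realType) (V : choiceType) (n : nat).
Implicit Types f : chain R V n.

Lemma chain_sqnormE f : l2 f -> chain_sqnorm f = (n`!%:R^-1 * nsq f)%:E.
Proof. by move=> lf; rewrite /chain_sqnorm nsqK. Qed.

Lemma fact_gt0R : 0 < n`!%:R^-1 :> R.
Proof. by rewrite invr_gt0 ltr0n fact_gt0. Qed.

Lemma chain_sqnorm_l2 f : (chain_sqnorm f < +oo)%E -> l2 f.
Proof.
rewrite /chain_sqnorm /l2 => lt.
have := tsum_ge0 (fun x => csq_ge0 (f x)); rewrite -[tsum _]/(l2sqnorm f).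
move: lt; case: (l2sqnorm f) => [r _ _|lt _|//]; first by rewrite ltry.
by move: lt; rewrite gt0_muley// lte_fin fact_gt0R.
Qed.

Lemma l2_chain_sqnorm f : l2 f -> (chain_sqnorm f < +oo)%E.
Proof. by move=> lf; rewrite chain_sqnormE// ltry. Qed.

(** From here on the space of boundaries is [[set fun=> 0]], which is what it is
    in the top dimension. *)
Lemma quot_sqnorm0 f : quot_sqnorm [set fun=> 0] f = chain_sqnorm f.
Proof.
rewrite /quot_sqnorm image_set1 ereal_inf1; congr chain_sqnorm.
by apply/funext => x; rewrite -[(f - _) x]/(f x - 0) subr0.
Qed.

End Chains.

Section Embeddings.
Variables (R : realType) (V : choiceType) (G : groupType) (a : gaction G V).
Variable n : nat.
Implicit Types (A : set (chain R V n)) (f : chain R V n).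

Lemma lregular_l2 m g (u : 'I_m * G -> R[i]) : l2 u -> l2 (lregular g u).
Proof.
pose e (y : 'I_m * G) := (y.1, (g^-1 * y.2)%g).
rewrite /l2 => lu; rewrite -[l2sqnorm _]/(tsum (fun y => csq (u (e y)))).
rewrite -(@tsum_reindex _ _ _ e (fun y => csq (u y)))//.
by exists (fun y => (y.1, (g * y.2)%g)) => -[i h];
  rewrite /e /= ?mulKg ?mulVKg.
Qed.

Lemma dot_lregular m g (u v : 'I_m * G -> R[i]) :
  dot (lregular g u) v = dot u (lregular g^-1 v).
Proof.
rewrite /dot (@rsum_reindex _ _ _ (fun y => (y.1, (g * y.2)%g))).
  congr rsum; apply/funext => -[i h].
  by rewrite /lregular /= mulKg invgK.
by exists (fun y => (y.1, (g^-1 * y.2)%g)) => -[i h] /=; rewrite ?mulKg ?mulVKg.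
Qed.

Section OneEmbedding.
Variables (A : set (chain R V n)) (m : nat).
Variables (phi : chain R V n -> 'I_m * G -> R[i])
          (p : 'I_m -> 'I_m * G -> R[i]).
Hypotheses (sA : l2subspace A) (gA : forall g f, A f -> A (gchain a g f)).
Hypothesis phiP : module_embedding a A [set fun=> 0] phi.

Lemma emb_sqnorm f : A f -> l2sqnorm (phi f) = (n`!%:R^-1 * nsq f)%:E.
Proof.
move=> Af; rewrite (emb_isometric phiP Af) quot_sqnorm0 chain_sqnormE//.
exact: subspace_l2 Af.
Qed.

Lemma emb_l2 f : A f -> l2 (phi f).
Proof. by move=> Af; rewrite /l2 emb_sqnorm// ltry. Qed.

Lemma emb_nsq f : A f -> nsq (phi f) = n`!%:R^-1 * nsq f.
Proof. by move=> Af; rewrite /nsq emb_sqnorm. Qed.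

Lemma emb_inj0 f : A f -> phi f = (fun=> 0) -> f = (fun=> 0).
Proof.
move=> Af f0; have := emb_nsq Af; rewrite f0 nsq_0 => /esym/eqP.
rewrite mulf_eq0 gt_eqF ?fact_gt0R//= => /eqP h.
by apply: nsq_eq0; [exact: subspace_l2 Af|rewrite h].
Qed.

Lemma emb_0 : phi (fun=> 0) = (fun=> 0).
Proof.
have A0 := subspace_0 sA; apply: nsq_eq0; first exact: emb_l2.
by rewrite emb_nsq// nsq_0 mulr0.
Qed.

Lemma image_subspace : l2subspace (phi @` A).
Proof.
split.
- by move=> _ [f Af <-]; exact: emb_l2.
- by exists (fun=> 0); [exact: subspace_0|exact: emb_0].
- move=> c _ _ [f Af <-] [h Ah <-]; exists (fun x => c * f x + h x).
    exact: subspace_lin.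
  exact: emb_linear phiP _ _ _ Af Ah.
Qed.

Lemma subspace_sum (K : Type) (s : seq K) (c : K -> R[i])
    (F : K -> chain R V n) :
  (forall k, A (F k)) -> A (fun x => \sum_(k <- s) c k * F k x).
Proof.
move=> AF; elim: s => [|k s IH].
  by under eq_fun do rewrite big_nil; exact: subspace_0.
by under eq_fun do rewrite big_cons; exact: subspace_lin.
Qed.

Lemma emb_sum (K : Type) (s : seq K) (c : K -> R[i]) (F : K -> chain R V n) :
  (forall k, A (F k)) ->
  phi (fun x => \sum_(k <- s) c k * F k x) =
  (fun y => \sum_(k <- s) c k * phi (F k) y).
Proof.
move=> AF; elim: s => [|k s IH].
  under eq_fun do rewrite big_nil; rewrite emb_0.
  by apply/funext => y; rewrite big_nil.
under eq_fun do rewrite big_cons.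
rewrite (emb_linear phiP)//; last exact: subspace_sum.
by rewrite IH; apply/funext => y; rewrite big_cons.
Qed.

Hypothesis pP : forall i, is_orthoproj (phi @` A) (dirac_fun R (i, 1%g)) (p i).

Lemma proj_mem i : (phi @` A) (p i).
Proof. by have [] := pP i. Qed.

Lemma proj_l2 i : l2 (p i).
Proof. exact: (subspace_l2 image_subspace (proj_mem i)). Qed.

Lemma dot_proj i w : (phi @` A) w -> dot (p i) w = complex.Re (w (i, 1%g)).
Proof.
move=> Ww; rewrite -dot_dirac [RHS]dotC.
exact: (orthoprojP image_subspace (l2_dirac _ _) (proj_mem i)).1.
Qed.

Lemma image_lregular g w : (phi @` A) w -> (phi @` A) (lregular g w).
Proof.
move=> [f Af <-]; exists (gchain a g f); first exact: gA.
exact: (emb_equivariant phiP).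
Qed.

(** The projection of the basis vector at [(i, g)] is the translate by [g] of
    [p i], because the image is invariant: so a finite amount of data determines
    all the coordinates of the elements of the image. *)
Lemma dot_proj_translate (c : R[i]) i g w : (phi @` A) w ->
  dot (fun y => c * lregular g (p i) y) w = cdot c (w (i, g)).
Proof.
move=> Ww; rewrite dotMl dot_lregular dot_proj; last first.
  by apply: image_lregular; exact: (subspace_scale _ image_subspace).
rewrite /lregular /= invgK mulg1.
by rewrite mulrC; case: c (w (i, g)) => [x y] [z t]; rewrite /cdot /=; ring.
Qed.

Lemma trace_proj i :
  complex.Re (l2dot (p i) (dirac_fun R (i, 1%g))) = nsq (p i).
Proof.
by rewrite l2dotE /= dot_dirac -(dot_proj i (proj_mem i)) nsqE// proj_l2.
Qed.

(** If the trace vanishes, so do all projections of basis vectors, hence all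
    coordinates of all the elements of the image. *)
Lemma trace_eq0 : \sum_(i < m) nsq (p i) <= 0 -> A `<=` [set fun=> 0].
Proof.
move=> tr0 f Af; apply: emb_inj0 => //.
have p0 i : p i = (fun=> 0).
  apply: (nsq_eq0 (proj_l2 i)).
  by apply: le_trans tr0; rewrite (bigD1 i)//= lerDl sumr_ge0// => j _;
    exact: nsq_ge0.
have Wf : (phi @` A) (phi f) by exists f.
apply/funext => -[i g].
have z c : cdot c (phi f (i, g)) = 0.
  rewrite -(dot_proj_translate c i g Wf) p0.
  have -> : (fun y => c * lregular g (fun=> 0 : R[i]) y) =
      (fun y : 'I_m * G => 0%:C%C * (0 : R[i])).
    by apply/funext => y; rewrite /lregular !mulr0.
  by rewrite dotZl ?mul0r//; [exact: l2_0|exact: emb_l2].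
by apply: csq_eq0; rewrite -cdotzz z.
Qed.

End OneEmbedding.

Section TwoEmbeddings.
Variables (A A' : set (chain R V n)) (m m' : nat).
Variables (phi : chain R V n -> 'I_m * G -> R[i])
          (p : 'I_m -> 'I_m * G -> R[i]).
Variables (phi' : chain R V n -> 'I_m' * G -> R[i])
          (p' : 'I_m' -> 'I_m' * G -> R[i]).
Hypotheses (sA : l2subspace A) (gA : forall g f, A f -> A (gchain a g f)).
Hypotheses (sA' : l2subspace A') (AA' : A `<=` A').
Hypothesis phiP : module_embedding a A [set fun=> 0] phi.
Hypothesis pP : forall i, is_orthoproj (phi @` A) (dirac_fun R (i, 1%g)) (p i).
Hypothesis phiP' : module_embedding a A' [set fun=> 0] phi'.
Hypothesis pP' : forall i,
  is_orthoproj (phi' @` A') (dirac_fun R (i, 1%g)) (p' i).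

Lemma emb_nsq_eq f : A f -> nsq (phi' f) = nsq (phi f).
Proof.
by move=> Af; rewrite (emb_nsq sA phiP Af) (emb_nsq sA' phiP' (AA' Af)).
Qed.

(** The map [T : phi f |-> phi' f] is an isometry of [phi @` A] into
    [phi' @` A'], so its adjoint does not increase norms. The [c k] are the
    conjugates of the coordinates of the adjoint image of [p' j]; the sum of
    their squares is bounded by testing [T] on the vector with coordinates
    [(c k)^*], projected to [phi @` A]. *)
Lemma bessel (F : 'I_m -> chain R V n) (j : 'I_m') (s : seq ('I_m * G)) :
  (forall i, A (F i)) -> (forall i, phi (F i) = p i) -> uniq s ->
  \sum_(k <- s) csq (phi' (gchain a k.2 (F k.1)) (j, 1%g)) <= nsq (p' j).
Proof.
move=> AF phiF us.
pose FF (k : 'I_m * G) := gchain a k.2 (F k.1).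
have AFF k : A (FF k) by exact: gA.
have AFF' k : A' (FF k) by exact: AA'.
pose c k := phi' (FF k) (j, 1%g).
rewrite -[leLHS]/(\sum_(k <- s) csq (c k)); set S := \sum_(k <- s) _.
pose f x := \sum_(k <- s) (c k)^* * FF k x.
have Af : A f by apply: subspace_sum.
have Wf : (phi @` A) (phi f) by exists f.
have lw := emb_l2 sA phiP Af.
have le1 : nsq (phi f) <= S.
  have E : nsq (phi f) = \sum_(k <- s) cdot (c k)^* (phi f k).
    rewrite nsqE// {1}(emb_sum sA phiP)//.
    have -> : (fun y => \sum_(k <- s) (c k)^* * phi (FF k) y) =
        (fun y => \sum_(k <- s) (c k)^* * lregular k.2 (p k.1) y).
      apply/funext => y; apply: eq_bigr => k _; congr (_ * _).
      by rewrite (emb_equivariant phiP)// phiF.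
    elim: (s) => [|[i g] t IH].
      rewrite big_nil; under eq_fun do rewrite big_nil.
      have -> : (fun=> 0 : R[i]) = (fun y : 'I_m * G => 0%:C%C * (0 : R[i])).
        by apply/funext => y; rewrite mulr0.
      by rewrite dotZl ?mul0r//; exact: l2_0.
    rewrite big_cons -IH -(dot_proj_translate sA gA phiP pP _ _ _ Wf) -dotDl//.
    - by under eq_fun do rewrite big_cons.
    - apply: l2_scale; apply: lregular_l2.
      exact: (proj_l2 sA phiP pP).
    - elim: (t) => [|k t' IH'].
        by under eq_fun do rewrite big_nil; exact: l2_0.
      under eq_fun do rewrite big_cons.
      apply: l2_lin IH'; apply: lregular_l2.
      exact: (proj_l2 sA phiP pP).
  have : 2 * nsq (phi f) <= S + nsq (phi f).
    apply: (@le_trans _ _ (S + \sum_(k <- s) csq (phi f k))); last first.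
      by rewrite lerD2l sum_csq_le.
    rewrite {1}E mulr_sumr -big_split/=; apply: ler_sum => k _.
    by rewrite -[csq (c k)]csq_conj cdot2_le.
  by lra.
have SE : S = complex.Re (phi' f (j, 1%g)).
  rewrite (emb_sum sA' phiP')//= raddf_sum; apply: eq_bigr => k _.
  rewrite -[phi' _ _]/(c k); case: (c k) => x y; rewrite /csq /=; ring.
have Wf' : (phi' @` A') (phi' f) by exists f => //; exact: AA'.
have := dot_le_nsq (proj_l2 sA' phiP' pP' j)
          (subspace_l2 (image_subspace sA' phiP') Wf').
by rewrite (dot_proj sA' phiP' pP')// -SE emb_nsq_eq//; lra.
Qed.

(** With [T] as in [bessel], the squares of all the coordinates of the vectors
    [T (p i)] are summed in two ways. Summing those of each [T (p i)] gives the
    trace for [phi]. By equivariance the coordinate of [T (p i)] at [(j, g)] is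
    the one of [T (g^-1 . p i)] at [(j, 1)], and for fixed [j] the sum of the
    squares of the latter is bounded by [bessel]. *)
Lemma trace_le : \sum_(i < m) nsq (p i) <= \sum_(j < m') nsq (p' j).
Proof.
have /choice[F FP] i : exists f, A f /\ phi f = p i.
  by have [f Af fp] := proj_mem pP i; exists f.
have E1 i : (nsq (p i))%:E =
    (\sum_(j < m') tsum (fun g => csq (phi' (F i) (j, g))))%E.
  have [AF pF] := FP i; rewrite -pF -(emb_nsq_eq AF) -nsqK; last first.
    exact: (emb_l2 sA' phiP' (AA' AF)).
  by apply: (tsum_ord (u := fun y => csq (phi' (F i) y))) => x; exact: csq_ge0.
rewrite -lee_fin -!sumEFin; under eq_bigr do rewrite E1.
rewrite exchange_big; apply: lee_sum => j _.
have -> : (\sum_(i < m) tsum (fun g => csq (phi' (F i) (j, g))) =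
    tsum (fun k : 'I_m * G => csq (phi' (gchain a k.2 (F k.1)) (j, 1%g))))%E.
  rewrite tsum_ord; last by move=> x; exact: csq_ge0.
  apply: eq_bigr => i _; have [AF _] := FP i.
  rewrite (@tsum_reindex _ _ _ (@invg G)); last first.
    by exists invg; exact: invgK.
  congr tsum; apply/funext => g /=; congr csq.
  by rewrite (emb_equivariant phiP' _ (AA' AF)) /lregular /= mulg1.
apply: tsum_le_seq => s us; by apply: bessel => // i; have [] := FP i.
Qed.

End TwoEmbeddings.
End Embeddings.

(** * Proper and cocompact actions *)
Definition locally_finite_complex (V : choiceType) (K : scomplex V) :=
  forall s, simplices K s -> finite_set [set v | simplices K (v |` s)%fset].

Section Translation.
Variables (G : groupType) (V : choiceType) (a : gaction G V).
Implicit Types (g h : G) (s t : {fset V}) (K L : scomplex V).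

Lemma gactK g : cancel (a g) (a g^-1%g).
Proof. by move=> v; rewrite -gactM mulVg gact1. Qed.

Lemma gactVK g : cancel (a g^-1%g) (a g).
Proof. by move=> v; rewrite -gactM mulgV gact1. Qed.

Lemma gact_bij g : bijective (a g).
Proof. by exists (a g^-1%g); [exact: gactK|exact: gactVK]. Qed.

Lemma mem_translate g s v : (v \in translate a g s) = (a g^-1%g v \in s).
Proof.
apply/imfsetP/idP => [[w ws ->]|vs]; first by rewrite gactK.
by exists (a g^-1%g v); rewrite ?gactVK.
Qed.

Lemma translate1 s : translate a 1%g s = s.
Proof. by apply/fsetP => v; rewrite mem_translate invg1 gact1. Qed.

Lemma translateM g h s : translate a (g * h)%g s =
  translate a g (translate a h s).
Proof. by apply/fsetP => v; rewrite !mem_translate invgM gactM. Qed.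

Lemma translateK g s : translate a g^-1%g (translate a g s) = s.
Proof. by rewrite -translateM mulVg translate1. Qed.

Lemma translateVK g s : translate a g (translate a g^-1%g s) = s.
Proof. by rewrite -translateM mulgV translate1. Qed.

Lemma translate_sub g s t :
  (s `<=` t)%fset -> (translate a g s `<=` translate a g t)%fset.
Proof.
by move=> /fsubsetP st; apply/fsubsetP => v; rewrite !mem_translate; exact: st.
Qed.

Lemma translate_neq0 g s : s != fset0 -> translate a g s != fset0.
Proof.
move=> /fset0Pn[v vs]; apply/fset0Pn; exists (a g v).
by rewrite mem_translate gactK.
Qed.

Lemma mem_simplex_of n (x : n.-tuple V) v : (v \in simplex_of x) =
  (v \in tval x).
Proof. by rewrite !inE. Qed.

Lemma simplex_of_map n g (x : n.-tuple V) :
  simplex_of (map_tuple (a g) x) = translate a g (simplex_of x).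
Proof.
apply/fsetP => v; rewrite mem_simplex_of mem_translate mem_simplex_of /=.
apply/mapP/idP => [[w wx ->]|vx]; first by rewrite gactK.
by exists (a g^-1%g v); rewrite ?gactVK.
Qed.

Lemma simplex_of_cons n v (y : n.-tuple V) :
  simplex_of [tuple of v :: y] = (v |` simplex_of y)%fset.
Proof. by apply/fsetP => w; rewrite !inE. Qed.

Lemma map_tupleM n g h (x : n.-tuple V) :
  map_tuple (a (g * h)%g) x = map_tuple (a g) (map_tuple (a h) x).
Proof.
apply/val_inj => /=; rewrite -map_comp; apply: eq_map => v; exact: gactM.
Qed.

Lemma map_tupleK n g (x : n.-tuple V) :
  map_tuple (a g^-1%g) (map_tuple (a g) x) = x.
Proof. by apply/val_inj => /=; rewrite mapK//; exact: gactK. Qed.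

Lemma map_tupleVK n g (x : n.-tuple V) :
  map_tuple (a g) (map_tuple (a g^-1%g) x) = x.
Proof. by apply/val_inj => /=; rewrite mapK//; exact: gactVK. Qed.

Lemma invariantE K g s : Defs.invariant a K ->
  simplices K (translate a g s) <-> simplices K s.
Proof.
by move=> iK; split=> [/(iK g^-1%g)|/(iK g)//]; rewrite translateK.
Qed.

(** A nonempty transporter is a coset of a stabilizer. *)
Lemma proper_transporter L s t : proper_action a L -> simplices L s ->
  finite_set [set g | translate a g s = t].
Proof.
move=> [_ pL] Ls; have [[g0 g0P]|no] := pselect (exists g, translate a g s = t).
  apply: (@sub_finite_set _ _
    ((fun g => (g0 * g)%g) @` [set g | translate a g s = s])).
    move=> g /= gs; exists (g0^-1 * g)%g; last by rewrite mulVKg.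
    by rewrite /= translateM gs -g0P translateK.
  by apply: finite_image; exact: pL.
rewrite (_ : [set g | _] = set0) //.
by apply/seteqP; split=> // g gs; apply: no; exists g.
Qed.

Section LocallyFinite.
Variables (L K : scomplex V).
Hypotheses (pL : proper_action a L) (KL : simplices K `<=` simplices L).
Hypotheses (iK : Defs.invariant a K) (cK : cocompact a K).

(** Up to translation there are finitely many flags made of a simplex and a
    face, and finitely many elements move the face to a given simplex. *)
Lemma cocompact_locally_finite : locally_finite_complex K.
Proof.
move=> s Ks; have [F finF FP] := cK.
apply: (@sub_finite_set _ _ (\bigcup_(t in F) \bigcup_(u in [set` fpowerset t])
    \bigcup_(h in [set h | translate a h s = u]) [set` translate a h^-1%g t])).
  move=> v /= /FP[g [t [Ft vs]]]; exists t => //.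
  have sub : (s `<=` translate a g t)%fset by rewrite -vs fsubsetU1.
  exists (translate a g^-1%g s).
    by rewrite /= fpowersetE -[t](translateK g); exact: translate_sub.
  by exists g^-1%g => //=; rewrite invgK -vs !inE eqxx.
apply: bigcup_finite => // t _; apply: bigcup_finite => [|u _].
  exact: finite_fset.
apply: bigcup_finite => [|h _]; last exact: finite_fset.
exact: proper_transporter pL (KL Ks).
Qed.

Lemma finite_simplex_of n s :
  finite_set [set x : n.-tuple V | simplex_of x = s].
Proof.
apply: (@sub_finite_set _ _ ((fun z : n.-tuple s => map_tuple val z) @` setT)).
  move=> x /= xs.
  have mem i : tnth x i \in s by rewrite -xs mem_simplex_of mem_tnth.
  exists [tuple [` mem i]%fset | i < n] => //.
  by apply: eq_from_tnth => i; rewrite tnth_map tnth_mktuple.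
by apply: finite_image; exact: finite_finset.
Qed.

(** A simplex has finitely many orderings, so there are finitely many orbits of
    ordered simplices. *)
Lemma orbit_representatives n : exists m (x : 'I_m -> n.-tuple V),
  (forall k, simplices K (simplex_of (x k))) /\
  (forall y, simplices K (simplex_of y) ->
     exists k g, y = map_tuple (a g) (x k)).
Proof.
have [F finF FP] := cK.
pose X0 := \bigcup_(t in F) [set x : n.-tuple V |
  simplex_of x = t /\ simplices K t].
have finX0 : finite_set X0.
  apply: bigcup_finite => // t _; apply: sub_finite_set (finite_simplex_of n t).
  by move=> x [].
pose r := enum_fset (fset_set X0).
exists (size r), (tnth (in_tuple r)); split=> [k|y Ky].
  have : tnth (in_tuple r) k \in fset_set X0 by exact: mem_tnth.
  by rewrite in_fset_set// inE => -[t _ [->]].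
have [g [t [Ft yt]]] := FP _ Ky.
have Kt : simplices K t by rewrite -(invariantE g _ iK) -yt.
have xX : map_tuple (a g^-1%g) y \in fset_set X0.
  rewrite in_fset_set// inE; exists t => //; split=> //.
  by rewrite simplex_of_map yt translateK.
have [k kx] := tnthP (in_tuple r) _ xX.
by exists k, g; rewrite -kx map_tupleVK.
Qed.

End LocallyFinite.
End Translation.

(** * Square summable cycles *)
Section PointwiseLimits.
Variables (R : realType) (X : choiceType).

Lemma csq_sum_le (s : seq (R[i] * X)) : exists2 k : R, 0 <= k &
  forall u : X -> R[i], l2 u -> csq (\sum_(z <- s) z.1 * u z.2) <= k * nsq u.
Proof.
elim: s => [|[c x] s [k k0 IH]].
  by exists 0 => // u _; rewrite big_nil csq0 mul0r.
exists (2 * csq c + 2 * k) => [|u lu].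
  by rewrite addr_ge0// mulr_ge0// csq_ge0.
rewrite big_cons; apply: le_trans (csqD _ _) _; rewrite csqM.
have := IH u lu; have := csq_le_nsq x lu; have := csq_ge0 c.
move=> c0 ux le2; rewrite [leRHS]mulrDl /=.
by apply: lerD; rewrite -mulrA ler_pM2l//; exact: ler_wpM2l.
Qed.

(** Each of the conditions that define the cycles of a locally finite complex
    has this form. *)
Lemma l2cvg_sum0 (s : seq (R[i] * X)) (f_ : nat -> X -> R[i]) f :
  (forall n, l2 (f_ n)) -> l2 f -> l2cvg f_ f ->
  (forall n, \sum_(z <- s) z.1 * f_ n z.2 = 0) -> \sum_(z <- s) z.1 * f z.2 = 0.
Proof.
move=> lf_ lf cv z; have [k k0 kP] := csq_sum_le s.
apply: csq_eq0; apply/ler_addgt0Pr => e e0; rewrite add0r.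
have k1 : 0 < k + 1 by rewrite ltr_wpDl.
have [n0 /(_ n0 (leqnn _)) le] := cv (e / (k + 1)) ltac:(by rewrite divr_gt0).
have -> : \sum_(z <- s) z.1 * f z.2 = - \sum_(z <- s) z.1 * (f_ n0 z.2 - f z.2).
  under [in RHS]eq_bigr do rewrite mulrBr.
  by rewrite sumrB z sub0r opprK.
rewrite csqN.
apply: le_trans (kP _ (l2_sub (lf_ n0) lf)) _.
apply: (@le_trans _ _ (k * (e / (k + 1)))); first exact: ler_wpM2l.
by rewrite mulrCA ger_pMr// ler_pdivrMr// mul1r lerDl.
Qed.

End PointwiseLimits.

Section Cycles.
Variables (R : realType) (V : choiceType) (G : groupType) (a : gaction G V).
Variable d : nat.
Implicit Types (K : scomplex V) (f : chain R V d.+1).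

Lemma cycles_l2 K f : cycles K f -> l2 f.
Proof. by move=> [[_ _ nf] _]; exact: chain_sqnorm_l2. Qed.

(** A simplex outside [K] is not a face of a simplex of [K], so the larger
    complex imposes no new condition on a cycle of [K]. *)
Lemma cycles_mono K K' : simplices K `<=` simplices K' ->
  cycles (R := R) K (k := d) `<=` cycles K' (k := d).
Proof.
move=> KK' f [[sf af nf] bf]; split.
  split=> // x /sf[ux Kx]; split=> //; exact: KK'.
apply/funext => y; rewrite /boundary; case: asboolP => // K'y.
have [Ky|nKy] := pselect (simplices K (simplex_of y)).
  have := congr1 (fun b => b y) bf; rewrite /boundary.
  by case: asboolP.
rewrite fsbig1// => v _; apply/eqP; apply: contrapT => /negP /sf[_ Kvy].
apply: nKy; apply: simplex_face Kvy (simplex_neq0 K'y) _.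
by rewrite simplex_of_cons fsubsetU1.
Qed.

(** The finite sum in the definition of the boundary is 0 by convention on an
    infinite support; local finiteness turns it into a sum over a fixed finite
    set of vertices, hence into a linear function of [f]. *)
Lemma boundary_finite K f y : locally_finite_complex K ->
  (forall x, f x != 0 -> simplices K (simplex_of x)) ->
  forall Ky : simplices K (simplex_of y),
  boundary K f y =
  \sum_(v <- fset_set [set v | simplices K (v |` simplex_of y)%fset])
     f [tuple of v :: y].
Proof.
move=> lfK sf Ky; rewrite /boundary asboolT//.
have fin := lfK _ Ky.
rewrite (fsbigE (fset_set [set v | simplices K (v |` simplex_of y)%fset]))//=.
  by apply: eq_bigl => v; rewrite in_setT.
move=> v _; rewrite in_fset_set// => nv; apply/eqP;
  apply: contrapT => /negP /sf.
by rewrite simplex_of_cons => Kv; move/negP: nv; apply; rewrite inE.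
Qed.

Lemma cycles_subspace K : locally_finite_complex K ->
  l2subspace (cycles (R := R) K (k := d)).
Proof.
move=> lfK; split; first by move=> f; exact: cycles_l2.
  split; first split.
  - by move=> x; rewrite eqxx.
  - by move=> s x; rewrite mulr0.
  - by apply: l2_chain_sqnorm; exact: l2_0.
  apply/funext => y; rewrite /boundary; case: ifP => // _.
  by rewrite fsbig1.
move=> c f g Cf Cg; have [[sf af nf] bf] := Cf; have [[sg ag ng] bg] := Cg.
have sfg x : c * f x + g x != 0 -> uniq x /\ simplices K (simplex_of x).
  have [->|f0 _] := eqVneq (f x) 0; last exact: sf.
  by rewrite mulr0 add0r; exact: sg.
split; first split=> //.
- by move=> s x; rewrite af ag mulrDr [c * (_ * _)]mulrCA.
- by apply: l2_chain_sqnorm; apply: l2_lin; apply: cycles_l2 _; eassumption.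
apply/funext => y.
have [Ky|nKy] := pselect (simplices K (simplex_of y)); last first.
  by rewrite /boundary asboolF.
rewrite boundary_finite//; last by move=> x /sfg[].
rewrite big_split -mulr_sumr/=.
rewrite -(@boundary_finite K f)//; last by move=> x /sf[].
rewrite -(@boundary_finite K g)//; last by move=> x /sg[].
by rewrite bf bg mulr0 addr0.
Qed.

Lemma cycles_closed K : locally_finite_complex K ->
  l2closed (cycles (R := R) K (k := d)).
Proof.
move=> lfK f_ f Cf_ lf cv.
have lf_ n : l2 (f_ n) by exact: cycles_l2 (Cf_ n).
have sf x : f x != 0 -> uniq x /\ simplices K (simplex_of x).
  move=> fx; apply: contrapT => nx; move/negP: fx; apply; apply/eqP.
  have := @l2cvg_sum0 _ _ [:: (1, x)] f_ f lf_ lf cv.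
  rewrite big_seq1 mul1r; apply => n; rewrite big_seq1 mul1r.
  have [[sfn _ _] _] := Cf_ n.
  by apply/eqP; apply: contrapT => /negP /sfn.
split; first split=> //.
- move=> s x; set y := [tuple _ | _ < _].
  have := @l2cvg_sum0 _ _ [:: (1, y); (- (-1) ^+ s, x)] f_ f lf_ lf cv.
  rewrite !big_cons big_nil /= addr0 mul1r mulNr => /(_ _)/eqP.
  rewrite subr_eq0 => h; apply/eqP/h => n.
  have [[_ afn _] _] := Cf_ n.
  by rewrite !big_cons big_nil /= addr0 mul1r mulNr afn subrr.
- exact: l2_chain_sqnorm.
apply/funext => y.
have [Ky|nKy] := pselect (simplices K (simplex_of y)); last first.
  by rewrite /boundary asboolF.
rewrite boundary_finite//; last by move=> x /sf[].
have := @l2cvg_sum0 _ _ [seq (1, [tuple of v :: y]) | v <-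
  fset_set [set v | simplices K (v |` simplex_of y)%fset]] f_ f lf_ lf cv.
rewrite big_map; under eq_bigr do rewrite mul1r.
apply => n; rewrite big_map; under eq_bigr do rewrite mul1r.
have [[sfn _ _] bfn] := Cf_ n.
rewrite -(@boundary_finite K (f_ n))//; last by move=> x /sfn[].
by rewrite bfn.
Qed.

Lemma gchain_bij g : bijective (map_tuple (n := d.+1) (a g)).
Proof.
by exists (map_tuple (a g^-1%g)) => x; rewrite ?map_tupleK ?map_tupleVK.
Qed.

Lemma gchain_l2 g f : l2 f -> l2 (gchain a g f).
Proof.
rewrite /l2 => lf.
rewrite -[l2sqnorm _]/(tsum (fun x => csq (f (map_tuple (a g^-1%g) x)))).
by rewrite -(tsum_reindex (fun x => csq (f x)) (gchain_bij g^-1%g)).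
Qed.

Lemma cycles_gchain K g f : Defs.invariant a K -> cycles K f ->
  cycles K (gchain a g f).
Proof.
move=> iK Cf; have [[sf af nf] bf] := Cf; split; first split.
- move=> x /sf[]; rewrite simplex_of_map => ux /(iK g); rewrite translateVK.
  by move: ux; rewrite /= map_inj_uniq//; exact/bij_inj/gact_bij.
- move=> s x; rewrite /gchain -af; congr f.
  by apply: eq_from_tnth => i; rewrite !(tnth_map, tnth_mktuple).
- by apply/l2_chain_sqnorm/gchain_l2; exact: cycles_l2 Cf.
apply/funext => y; rewrite /boundary; case: asboolP => // Ky.
have := congr1 (fun b => b (map_tuple (a g^-1%g) y)) bf;
  rewrite /boundary asboolT; last first.
  by rewrite simplex_of_map; exact: iK.
rewrite (reindex_fsbigT (a g^-1%g)) => [e|]; last exact: gact_bij.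
rewrite -[RHS]e.
apply: eq_fsbigr => v _; rewrite /gchain; congr f.
exact/val_inj.
Qed.

End Cycles.

(** * Existence and properties of the von Neumann dimension *)
Section TsumSwap.
Variable R : realType.

Lemma tsum_swap (X Y : choiceType) (u : X -> Y -> R) :
  (forall x y, 0 <= u x y) ->
  \esum_(x in [set: X]) tsum (u x) =
  \esum_(y in [set: Y]) tsum (fun x => u x y).
Proof.
move=> u0; rewrite !esum_esum; try by move=> x y _ _; rewrite lee_fin.
apply: (@reindex_esum _ _ _ _ _ (fun z : Y * X => (z.2, z.1))); split=> //.
  by move=> [y x] [y' x'] _ _ /= [-> ->].
by move=> [x y] _; exists (y, x).
Qed.

End TsumSwap.

Section EmbeddingExists.
Variables (R : realType) (V : choiceType) (G : groupType) (a : gaction G V).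
Variables (L K : scomplex V) (n m : nat) (x : 'I_m -> n.-tuple V).
Hypotheses (pL : proper_action a L) (KL : simplices K `<=` simplices L).
Hypothesis xK : forall k, simplices K (simplex_of (x k)).
Hypothesis xP : forall y, simplices K (simplex_of y) ->
  exists k g, y = map_tuple (a g) (x k).

Let mv (z : 'I_m * G) := map_tuple (a z.2) (x z.1).

Let ind y z : R := (mv z == y)%:R.

Let ind_ge0 y z : 0 <= ind y z.
Proof. exact: ler0n. Qed.

(** The number of ways of reaching an ordered simplex from the representatives.
    It accounts both for stabilizers and for representatives of a same orbit. *)
Let mult y : R := fine (tsum (ind y)).

Let finite_fiber y : finite_set [set z | mv z = y].
Proof.
apply: (@sub_finite_set _ _ (\bigcup_(k in [set: 'I_m])
   (fun g => (k, g)) @` [set g | translate a g (simplex_of (x k)) =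
     simplex_of y])).
  move=> [k g] /= <-; exists k => //; exists g => //=.
  by rewrite simplex_of_map.
apply: bigcup_finite => [|k _]; first exact: finite_finset.
by apply: finite_image; apply: proper_transporter pL _; exact/KL/xK.
Qed.

Let multE y : tsum (ind y) = (mult y)%:E.
Proof.
rewrite fineK// ge0_fin_numE ?tsum_ge0//.
apply: (@le_lt_trans _ _ ((#|` fset_set [set z | mv z = y]|%:R : R)%:E));
  last first.
  by rewrite ltry.
apply: tsum_le_seq => s us; rewrite -natr_sum ler_nat.
rewrite -big_mkcond/= sum1_count -size_filter.
apply: uniq_leq_size; first exact: filter_uniq.
move=> z; rewrite mem_filter => /andP[/eqP zy _].
by rewrite in_fset_set// inE.
Qed.

Let mult_ge1 y : simplices K (simplex_of y) -> 1 <= mult y.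
Proof.
move=> /xP[k [g yE]]; rewrite -lee_fin -multE.
have := @tsum_ge_seq R _ (ind y) [:: (k, g)] isT (ind_ge0 y).
by rewrite big_seq1 {1}/ind yE eqxx.
Qed.

Let mult_translate g y : mult (map_tuple (a g) y) = mult y.
Proof.
congr fine.
rewrite (@tsum_reindex R _ _ (fun z : 'I_m * G => (z.1, (g * z.2)%g)));
  last first.
  by exists (fun z => (z.1, (g^-1 * z.2)%g)) => -[k h] /=;
    rewrite ?mulKg ?mulVKg.
congr tsum; apply/funext => -[k h]; rewrite /ind /mv /= map_tupleM.
by rewrite (inj_eq (bij_inj (Bijective (map_tupleK a g) (map_tupleVK a g)))).
Qed.

Let weight y : R := Num.sqrt (n`!%:R * mult y)^-1.

Definition orbit_embedding (f : chain R V n) (z : 'I_m * G) : R[i] :=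
  (weight (mv z))%:C%C * f (mv z).

(** Each ordered simplex [y] is met [mult y] times, so dividing the squares of
    the values by [mult y] gives an isometry; the factorial is the one of
    [chain_sqnorm]. Equivariance holds as [mult] is invariant. *)
Lemma orbit_embeddingP A : A `<=` [set f | l2 f /\
    forall y, f y != 0 -> simplices K (simplex_of y)] ->
  module_embedding a A [set fun=> 0] orbit_embedding.
Proof.
move=> AK; split.
- move=> c f h _ _; apply/funext => z; rewrite /orbit_embedding.
  by rewrite mulrDr [c * (_ * _)]mulrCA.
- move=> g f _; apply/funext => -[k h]; rewrite /lregular /orbit_embedding /=.
  have -> : mv (k, (g^-1 * h)%g) = map_tuple (a g^-1%g) (mv (k, h)).
    exact: map_tupleM.
  by rewrite /weight mult_translate.
move=> f /AK[lf sf]; rewrite quot_sqnorm0.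
pose w y : R := (n`!%:R * mult y)^-1 * csq (f y).
have mult0 y : 0 <= mult y by rewrite -lee_fin -multE tsum_ge0.
have w0 y : 0 <= w y.
  by rewrite mulr_ge0 ?csq_ge0// invr_ge0 mulr_ge0// ler0n.
have E z : csq (orbit_embedding f z) = w (mv z).
  rewrite /orbit_embedding csqM /w /weight; congr (_ * _).
  by rewrite /csq /= expr0n addr0 sqr_sqrtr// invr_ge0 mulr_ge0// ler0n.
transitivity (\esum_(z in [set: 'I_m * G]) tsum (fun y => w y * ind y z)).
  apply: eq_esum => z _.
  rewrite -[(_ + _)%:E]/((csq (orbit_embedding f z))%:E) E.
  rewrite (@tsum_single _ _ _ (mv z)) ?/ind ?eqxx ?mulr1//.
  by move=> y /negbTE; rewrite eq_sym => ->; rewrite mulr0.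
rewrite (@tsum_swap _ _ _ (fun z y => w y * ind y z)); last first.
  by move=> z y; rewrite mulr_ge0.
rewrite /chain_sqnorm -[l2sqnorm f]/(tsum (fun y => csq (f y))).
rewrite -tsum_scale; [|by rewrite invr_ge0 ler0n|by move=> y; exact: csq_ge0].
apply: eq_esum => y _; rewrite tsum_scale// multE -EFinM; congr EFin.
have [f0|/sf Ky] := eqVneq (f y) 0.
  by rewrite /w f0 csq0 !mulr0 mul0r.
have m0 : mult y != 0 by rewrite gt_eqF// (lt_le_trans ltr01)// mult_ge1.
by rewrite /w invfM mulrAC mulfVK.
Qed.

End EmbeddingExists.

Section VonNeumannDimension.
Variables (R : realType) (V : choiceType) (G : groupType) (a : gaction G V).
Variable n : nat.
Implicit Types (A : set (chain R V n)).

Lemma image_complete A m (phi : chain R V n -> 'I_m * G -> R[i]) :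
  l2subspace A -> l2complete A -> module_embedding a A [set fun=> 0] phi ->
  l2complete (phi @` A).
Proof.
move=> sA cA phiP w_ Ww cw.
have /choice[f_ f_P] k : exists f, A f /\ phi f = w_ k.
  by have [f Af fw] := Ww k; exists f.
have phiB f h : A f -> A h ->
    nsq (fun y => phi f y - phi h y) = n`!%:R^-1 * nsq (fun x => f x - h x).
  move=> Af Ah; rewrite -(emb_nsq sA phiP); last exact: subspace_sub.
  have -> : (fun x => f x - h x) = (fun x => (-1) * h x + f x).
    by apply/funext => x; rewrite mulN1r addrC.
  by rewrite (emb_linear phiP)//; congr nsq; apply/funext => y;
    rewrite mulN1r addrC.
have n0 : 0 < n`!%:R :> R by rewrite ltr0n fact_gt0.
have [||f Af cvf] := cA f_; first by move=> k; have [] := f_P k.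
  move=> e e0; have [k0 k0P] := cw (n`!%:R^-1 * e)
    ltac:(by rewrite mulr_gt0// invr_gt0).
  exists k0 => k l kk0 lk0; have := k0P k l kk0 lk0.
  have [[Ak <-] [Al <-]] := (f_P k, f_P l).
  by rewrite phiB// ler_pM2l ?invr_gt0.
exists (phi f); first by exists f.
move=> e e0; have [k0 k0P] := cvf (n`!%:R * e) ltac:(by rewrite mulr_gt0).
exists k0 => k kk0; have [Ak <-] := f_P k.
rewrite phiB// -(ler_pM2l n0) mulrA mulfV ?gt_eqF// mul1r.
exact: k0P.
Qed.

Lemma is_vNdim_exists A m (phi : chain R V n -> 'I_m * G -> R[i]) :
  l2subspace A -> l2complete A -> module_embedding a A [set fun=> 0] phi ->
  exists x, is_vNdim a A [set fun=> 0] x.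
Proof.
move=> sA cA phiP.
have /choice[p pP] i :
    exists p, is_orthoproj (phi @` A) (dirac_fun R (i, 1%g)) p.
  apply: orthoproj_exists (l2_dirac _ _).
  - exact: image_subspace phiP.
  - exact: image_complete phiP.
by eexists; exists m, phi, p; split.
Qed.

(** Applied to [A = A'], this says that the dimension does not depend on the
    embedding. *)
Lemma is_vNdim_le A A' x x' : l2subspace A -> l2subspace A' ->
  (forall g f, A f -> A (gchain a g f)) -> A `<=` A' ->
  is_vNdim a A [set fun=> 0] x -> is_vNdim a A' [set fun=> 0] x' -> (x <= x')%E.
Proof.
move=> sA sA' gA AA' [m [phi [p [phiP pP ->]]]] [m' [phi' [p' [phiP' pP' ->]]]].
rewrite lee_fin.
under eq_bigr do rewrite (trace_proj sA phiP pP).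
under [leRHS]eq_bigr do rewrite (trace_proj sA' phiP' pP').
exact: trace_le phiP pP phiP' pP'.
Qed.

Lemma is_vNdim_ge0 A x : l2subspace A -> is_vNdim a A [set fun=> 0] x ->
  (0 <= x)%E.
Proof.
move=> sA [m [phi [p [phiP pP ->]]]].
under eq_bigr do rewrite (trace_proj sA phiP pP).
by rewrite lee_fin sumr_ge0// => i _; exact: nsq_ge0.
Qed.

Lemma is_vNdim_eq0 A : l2subspace A ->
  (forall g f, A f -> A (gchain a g f)) ->
  is_vNdim a A [set fun=> 0] 0%E -> A `<=` [set fun=> 0].
Proof.
move=> sA gA [m [phi [p [phiP pP]]]].
under eq_bigr do rewrite (trace_proj sA phiP pP).
by move=> [] /esym tr0; apply: (trace_eq0 sA gA phiP pP); rewrite tr0.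
Qed.

Lemma is_vNdim_trivial A x : A `<=` [set fun=> 0] ->
  is_vNdim a A [set fun=> 0] x -> x = 0%E.
Proof.
move=> A0 [m [phi [p [phiP pP ->]]]]; congr EFin; apply: big1 => i _.
have [[f Af fp] _] := pP i; have f0 := A0 _ Af.
have p0 : p i = (fun=> 0).
  have lp : l2sqnorm (p i) = 0%E.
    rewrite -fp (emb_isometric phiP Af) quot_sqnorm0 f0 chain_sqnormE;
      last exact: l2_0.
    by rewrite nsq_0 mulr0.
  by apply: nsq_eq0; rewrite /l2 /nsq lp// ltry.
by rewrite l2dotE /= dot_dirac p0.
Qed.

End VonNeumannDimension.

(** * Exhaustions *)
Section Complexes.
Variables (G : groupType) (V : choiceType) (a : gaction G V).
Implicit Types (K L : scomplex V).

Lemma countable_enum (T : Type) (A : set T) : countable A -> A !=set0 ->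
  exists e : nat -> T, A = range e.
Proof.
move=> /countable_injP[f finj] [x0 Ax0].
have /choice[e eP] k : exists x, A x /\ forall y, A y -> f y = k -> y = x.
  have [[y [Ay yk]]|no] := pselect (exists y, A y /\ f y = k).
    exists y; split=> // z Az zk; apply: finj; rewrite ?inE//.
    by rewrite zk yk.
  by exists x0; split=> // y Ay yk; case: no; exists y.
exists e; apply/seteqP; split=> [x Ax|_ [k _ <-]]; last by have [] := eP k.
by exists (f x) => //; rewrite [RHS]((eP (f x)).2 x).
Qed.

(** The [i]-th subcomplex consists of the translates of the faces of the first
    [i.+1] simplices of an enumeration. *)
Lemma exhaustion_exists L : countable (simplices L) -> simplices L !=set0 ->
  Defs.invariant a L -> exists Ls, exhaustion a L Ls.
Proof.
move=> cL neL iL; have [e eP] := countable_enum cL neL.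
have Le k : simplices L (e k) by rewrite eP; exists k.
pose S i := [set s : {fset V} | s != fset0 /\
  exists g k, (k <= i)%N /\ (translate a g s `<=` e k)%fset].
have S0 i s : S i s -> s != fset0 by move=> [].
have Sf i (s t : {fset V}) : S i s -> t != fset0 -> (t `<=` s)%fset -> S i t.
  move=> [_ [g [k [ki sub]]]] t0 ts; split=> //; exists g, k; split=> //.
  by apply: fsubset_trans sub; exact: translate_sub.
exists (fun i => SComplex (S0 i) (Sf i)); split=> /=.
- move=> i g s [s0 [h [k [ki sub]]]]; split; first exact: translate_neq0.
  by exists (h * g^-1)%g, k; split=> //; rewrite translateM translateK.
- move=> i; exists (\bigcup_(k in `I_i.+1) [set` fpowerset (e k)]).
    apply: bigcup_finite => [|k _]; first exact: finite_II.
    exact: finite_fset.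
  move=> s [s0 [g [k [ki sub]]]]; exists g^-1%g, (translate a g s).
  split; last by rewrite translateK.
  by exists k => //=; rewrite fpowersetE.
- move=> i s [s0 [g [k [ki sub]]]]; split=> //; exists g, k; split=> //.
  exact: leqW.
apply/seteqP; split=> [s [i _ [s0 [g [k [_ sub]]]]]|s Ls].
  have := simplex_face (Le k) (translate_neq0 a g s0) sub.
  by rewrite invariantE.
have := Ls; rewrite eP => -[k _ ek]; exists k => //; split.
  exact: simplex_neq0 Ls.
by exists 1%g, k; split=> //; rewrite translate1 ek.
Qed.

Lemma exhaustion_mono L Ls i j : exhaustion a L Ls -> (i <= j)%N ->
  simplices (Ls i) `<=` simplices (Ls j).
Proof.
move=> [_ _ inc _] /subnKC <-; elim: (j - i)%N => [|k IH];
  first by rewrite addn0.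
by rewrite addnS; apply: subset_trans IH _; exact: inc.
Qed.

Lemma exhaustion_sub L Ls i : exhaustion a L Ls ->
  simplices (Ls i) `<=` simplices L.
Proof. by move=> [_ _ _ <-] s Lis; exists i. Qed.

(** A finite set of simplices lies in some member of an exhaustion, and members
    are invariant. *)
Lemma exhaustion_absorbs L Ls (F : set {fset V}) : exhaustion a L Ls ->
  finite_set F -> F `<=` simplices L ->
  exists i, forall g t, F t -> simplices (Ls i) (translate a g t).
Proof.
move=> ex finF FL; have [inv _ _ un] := ex.
have /choice[j jP] t : exists j, F t -> simplices (Ls j) t.
  have [Ft|nFt] := pselect (F t); last by exists 0%N.
  by have := FL _ Ft; rewrite -un => -[j _ jt]; exists j.
exists (\max_(t <- fset_set F) j t)%N => g t Ft; apply: inv.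
apply: (exhaustion_mono ex _ (jP t Ft)).
by apply: leq_bigmax_seq => //; rewrite in_fset_set// inE.
Qed.

Lemma exhaustion_locally_finite_complex L Ls i : proper_action a L ->
  exhaustion a L Ls -> locally_finite_complex (Ls i).
Proof.
move=> pL ex; have [inv coc _ _] := ex.
exact: cocompact_locally_finite pL (exhaustion_sub ex (i := i)) (coc i).
Qed.

End Complexes.

(** * Betti numbers in the top degree *)
Section TopDegree.
Variables (R : realType) (V : choiceType) (d : nat) (L : scomplex V).
Hypothesis dimL : forall s, simplices L s -> (#|` s| <= d.+1)%N.

Lemma l2chains_above_top (c : chain R V d.+2) : l2chains L c -> c = (fun=> 0).
Proof.
move=> [sc _ _]; apply/funext => x; apply/eqP; apply: contrapT => /negP /sc[ux].
move=> /dimL; rewrite /simplex_of card_fseq undup_id// size_tuple.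
by rewrite ltnn.
Qed.

Lemma boundary0 (n : nat) : boundary L (fun=> 0 : R[i]) =
  (fun=> 0) :> chain R V n.
Proof.
by apply/funext => y; rewrite /boundary; case: ifP => // _; rewrite fsbig1.
Qed.

Lemma top_boundary_closure : boundary_closure L (k := d) = [set fun=> 0 : R[i]].
Proof.
apply/seteqP; split=> [b [[_ _ nb] small]|_ ->].
  have lb := chain_sqnorm_l2 nb; apply: (nsq_eq0 lb).
  apply/ler_addgt0Pr => e e0; rewrite add0r.
  have [|c /l2chains_above_top ->] := small (d.+1`!%:R^-1 * e).
    by rewrite mulr_gt0// fact_gt0R.
  rewrite boundary0 (_ : b - _ = b); last first.
    by apply/funext => x; rewrite -[(b - _) x]/(b x - 0) subr0.
  by rewrite chain_sqnormE// lte_fin ltr_pM2l ?fact_gt0R// => /ltW.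
have z n : l2chains (n := n) L (fun=> 0 : R[i]).
  split=> [x|s x|]; rewrite ?eqxx ?mulr0//.
  by apply: l2_chain_sqnorm; exact: l2_0.
split; first exact: z.
move=> e e0; exists (fun=> 0); first exact: z.
rewrite boundary0 subrr chain_sqnormE; last exact: l2_0.
by rewrite nsq_0 mulr0 lte_fin.
Qed.

(** Without boundaries, homology classes are cycles and the maps induced by
    inclusions are injective; their images are closed by [cycles_closed]. *)
Lemma cycles_image_closure (K : scomplex V) : simplices K `<=` simplices L ->
  locally_finite_complex K ->
  quot_image_closure (cycles L (k := d)) (boundary_closure L (k := d))
    (cycles K (k := d)) = cycles (R := R) K (k := d).
Proof.
move=> KL lfK; rewrite top_boundary_closure; apply/seteqP; split=> f;
  last first.
  move=> Cf; split=> [|e e0]; first exact: cycles_mono KL _ Cf.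
  exists f => //; rewrite subrr quot_sqnorm0 chain_sqnormE; last exact: l2_0.
  by rewrite nsq_0 mulr0 lte_fin.
move=> [Cf app]; have lf := cycles_l2 Cf.
have app' (e : R) : 0 < e -> exists s, cycles K s /\
  nsq (fun x => s x - f x) <= e.
  move=> e0; have [|s Cs] := app (d.+1`!%:R^-1 * e).
    by rewrite mulr_gt0// fact_gt0R.
  have ls := cycles_l2 Cs.
  rewrite quot_sqnorm0 (_ : f - s = fun x => f x - s x)// chain_sqnormE;
    last exact: l2_sub.
  by rewrite lte_fin ltr_pM2l ?fact_gt0R// nsqC => /ltW le; exists s.
have /choice[s_ s_P] n := app' n.+1%:R^-1 ltac:(by rewrite invr_gt0).
apply: (cycles_closed lfK (f_ := s_)) => // [n|]; first by have [] := s_P n.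
move=> e e0; have [n0 n0P] := inv_succ_le e0; exists n0 => n n0n.
exact: le_trans (s_P n).2 (n0P _ n0n).
Qed.

Variables (G : groupType) (a : gaction G V).

Lemma homology_image_dim0 (K : scomplex V) :
  cycles (R := R) K (k := d) `<=` [set fun=> 0] ->
  homology_image_dim R a K L d = 0%E.
Proof.
move=> K0; rewrite /homology_image_dim top_boundary_closure /vNdim.
set A := quot_image_closure _ _ _.
have A0 : A `<=` [set fun=> 0].
  move=> f [Cf app]; have lf := cycles_l2 Cf; apply: (nsq_eq0 lf).
  apply/ler_addgt0Pr => e e0; rewrite add0r.
  have [|s /K0 ->] := app (d.+1`!%:R^-1 * e).
    by rewrite mulr_gt0// fact_gt0R.
  rewrite (_ : f - _ = f); last first.
    by apply/funext => x; rewrite -[(f - _) x]/(f x - 0) subr0.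
  rewrite quot_sqnorm0 chain_sqnormE//.
  by rewrite lte_fin ltr_pM2l ?fact_gt0R// => /ltW.
have [ex|no] := pselect (exists x, is_vNdim a A [set fun=> 0] x).
  exact: is_vNdim_trivial A0 (getPex ex).
by rewrite getPN// => x Ax; apply: no; exists x.
Qed.

End TopDegree.

Section TopBetti.
Variables (R : realType) (V : choiceType) (d : nat) (L : scomplex V).
Hypothesis dimL : forall s, simplices L s -> (#|` s| <= d.+1)%N.
Variables (G : groupType) (a : gaction G V) (Ls : nat -> scomplex V).
Hypothesis exLs : exhaustion a L Ls.

Let dimLs i s : simplices (Ls i) s -> (#|` s| <= d.+1)%N.
Proof. by move=> Ks; apply: dimL; exact: exhaustion_sub exLs _ Ks. Qed.

Lemma l2betti_along_eq0 :
  (forall i, cycles (R := R) (Ls i) (k := d) `<=` [set fun=> 0]) ->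
  l2betti_along R a Ls d = 0%E.
Proof.
move=> Z0; rewrite /l2betti_along.
have lim0 : limn (fun=> 0%E : \bar R) = 0%E.
  by apply: lim_cst; exact: ereal_hausdorff.
rewrite [X in limn X](_ : _ = fun=> 0%E)//; apply/funext => i.
rewrite [X in limn X](_ : _ = fun=> 0%E)//; apply/funext => j.
by apply: homology_image_dim0 => // s; exact: dimLs.
Qed.

Hypothesis pL : proper_action a L.

Let lfL i : locally_finite_complex (Ls i).
Proof. exact: exhaustion_locally_finite_complex pL exLs. Qed.

Let Z i := cycles (R := R) (Ls i) (k := d).

Let sZ i : l2subspace (Z i). Proof. exact: cycles_subspace. Qed.

Let gZ i g f : Z i f -> Z i (gchain a g f).
Proof. by apply: cycles_gchain; exact: (exh_invariant exLs (i := i)). Qed.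

Let dimP i : is_vNdim a (Z i) [set fun=> 0] (vNdim a (Z i) [set fun=> 0]).
Proof.
apply: getPex; have sub := exhaustion_sub exLs (i := i).
have [m [x [xK xP]]] := orbit_representatives (exh_invariant exLs (i := i))
  (exh_cocompact exLs i) d.+1.
apply: is_vNdim_exists (orbit_embeddingP pL sub xK xP _) => //.
  by apply: closed_complete; [exact: sZ|exact/cycles_closed/lfL].
move=> f Zf; split; first exact: cycles_l2 Zf.
by move: Zf => [[sf _ _] _] y /sf[].
Qed.

(** The inner limit is one of a constant sequence, and the outer one is that of
    a nondecreasing sequence with a positive term. *)
Lemma l2betti_along_neq0 i f : cycles (R := R) (Ls i) (k := d) f ->
  f <> (fun=> 0) -> l2betti_along R a Ls d <> 0%E.
Proof.
move=> Zf f0; rewrite /l2betti_along.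
rewrite [X in limn X](_ : _ = fun i => vNdim a (Z i) [set fun=> 0]); last first.
  apply/funext => j; apply/lim_near_cst; first exact: ereal_hausdorff.
  apply: nearW => k; rewrite /homology_image_dim.
  have dimk s : simplices (Ls (j + k)) s -> (#|` s| <= d.+1)%N by exact: dimLs.
  rewrite cycles_image_closure//; last first.
    exact: exhaustion_mono exLs (leq_addr _ _).
  by rewrite top_boundary_closure.
set D := fun i => vNdim _ _ _.
have D0 : (0 < D i)%E.
  rewrite lt_neqAle (is_vNdim_ge0 (sZ i) (dimP i)) andbT.
  apply/eqP => Di0; have := dimP i; rewrite -[vNdim _ _ _]/(D i) -Di0.
  by move=> /(is_vNdim_eq0 (sZ i) (gZ (i := i))) /(_ f Zf).
have Dmono : {homo D : i j / (i <= j)%N >-> (i <= j)%E}.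
  move=> j k jk; apply: is_vNdim_le (dimP j) (dimP k) => //.
    by move=> g h; exact: gZ.
  by apply: cycles_mono; exact: exhaustion_mono exLs jk.
rewrite (cvg_lim (@ereal_hausdorff _) (ereal_nondecreasing_cvgn Dmono)).
apply/eqP; rewrite gt_eqF//; apply: lt_le_trans D0 _.
by apply: ereal_sup_ubound; exists i.
Qed.

End TopBetti.

Local Open Scope ereal_scope.

Theorem theorem1p8 (R : realType)
    (Gamma : groupType) (S : {pred Gamma}) (Lambda : subGroupType S)
    (V : choiceType) (L : scomplex V) (d : nat) (a : gaction Gamma V)
    (Gamma_countable : countable [set: Gamma])
    (L_dim : has_dim L d)
    (L_countable : countable (simplices L))
    (a_proper : proper_action a L)
    (betti_Lambda : l2betti R (restr_gaction Lambda a) L d <> 0) :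
  l2betti R a L d <> 0.
Proof.
have [dimL [s0 Ls0 _]] := L_dim.
pose b := restr_gaction Lambda a.
have [Ks exK bK] : exists2 Ks, exhaustion b L Ks &
  l2betti_along R b Ks d <> 0%E.
  have [ex|no] := pselect (exists x, exists2 Ks, exhaustion b L Ks &
      x = l2betti_along R b Ks d).
    have [Ks exK e] := getPex ex; exists Ks => //.
    by rewrite -e; exact: betti_Lambda.
  by case: betti_Lambda; rewrite /l2betti getPN// => x Px; apply: no; exists x.
have [k [f [Zf f0]]] : exists k f,
    cycles (R := R) (Ks k) (k := d) f /\ f <> (fun=> 0%R).
  apply: contrapT => no; apply: bK.
  apply: (l2betti_along_eq0 dimL exK) => k f Zf.
  by apply: contrapT => f0; apply: no; exists k, f.
rewrite /l2betti.
have /getPex[Ls exL ->] : exists x, exists2 Ls, exhaustion a L Ls &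
    x = l2betti_along R a Ls d.
  have [|Ls exL] := exhaustion_exists L_countable _ a_proper.1.
    by exists s0.
  by eexists; exists Ls.
have [F finF FP] := exh_cocompact exK k.
have [|i iP] :=
  exhaustion_absorbs exL (F := F `&` simplices L) _ (@subIsetr _ _ _).
  exact: finite_setIl.
apply: (l2betti_along_neq0 dimL exL a_proper (i := i)) f0.
apply: cycles_mono Zf => s Ks_s; have [g [t [Ft st]]] := FP s Ks_s.
rewrite st; apply: iP; split=> //; apply: (exhaustion_sub exK (i := k)).
by rewrite -(invariantE g _ (exh_invariant exK (i := k))) -st.
Qed.
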